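(* Let $(G,H)$ be a reduced Hecke pair with Schlichting completion $(\overline G,\overline H)$, let $p=\chi_{\overline H}\in C_c(\overline G)$, $A=C^*(\overline G)$, and let $\mathcal{H}=pC_c(\overline G)p$ be the Hecke algebra. If $(G,H)$ is directed, then the right inner product $\langle f,g\rangle_R=f^*g$ is positive on $C_c(\overline G)p$, i.e. for every $f\in C_c(\overline G)p$ there exist $n\ge 1$ and $g_1,\dots,g_n\in\mathcal{H}$ with $f^*f=\sum_{i=1}^n g_i^*g_i$; hence $C^*(\mathcal{H})=pAp$.
   Context: $(G,H)$ ($H$ a subgroup of a group $G$) is a Hecke pair if every double coset $HxH$ is a finite union of left cosets of $H$; it is reduced if $\bigcap_{x\in G}xHx^{-1}=\{e\}$. Let $\mathrm{Map}(G/H)$ be the set of all maps $G/H\to G/H$ with the topology of pointwise convergence ($G/H$ discrete), and let $\theta(x)(yH)=xyH$. The Schlichting completion is $\overline G=\overline{\theta(G)}$, $\overline H=\overline{\theta(H)}$ (closures in $\mathrm{Map}(G/H)$); $\overline G$ is a locally compact group of permutations of $G/H$, $\overline H$ is a compact open subgroup, and $G$ is identified with the dense subgroup $\theta(G)$. The pair $(G,H)$ is directed if $G=T^{-1}T$, where $T=\{t\in G: tHt^{-1}\supseteq H\}$. Left Haar measure on $\overline G$ is normalized so that $\overline H$ has measure $1$; $C_c(\overline G)$ is the usual convolution $*$-algebra with $f^*(x)=\overline{f(x^{-1})}\Delta(x^{-1})$, viewed inside the full group $C^*$-algebra $A=C^*(\overline G)$. Then $p=\chi_{\overline H}$ is a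 projection, and the Hecke algebra of $(G,H)$ is identified with the $*$-algebra $\mathcal{H}=pC_c(\overline G)p$ (via $\chi_{HxH}\leftrightarrow\chi_{\overline Hx\overline H}$), which is dense in $pAp$. The notation $C^*(\mathcal{H})=pAp$ means that $pAp$ is the enveloping $C^*$-algebra of $\mathcal{H}$: every $*$-representation of $\mathcal{H}$ by bounded operators on a Hilbert space extends to a $*$-representation of $pAp$. *)

(* Defs.v *)
From HB Require Import structures.
From mathcomp Require Import all_boot all_order all_algebra.
From mathcomp Require Import complex.
From mathcomp Require Import all_classical all_reals all_analysis.

Set Implicit Arguments.
Unset Strict Implicit.
Unset Printing Implicit Defensive.

Import Order.TTheory GRing.Theory Num.Theory.
Import numFieldNormedType.Exports.

Local Open Scope classical_set_scope.
Local Open Scope ring_scope.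
Local Open Scope complex_scope.

Section HeckePair.
Variables (G : groupType) (H : groupClosed G).

Definition lcoset (x : G) : set G := [set (x * h)%g | h in [set` H]].

Definition dcoset (x : G) : set G :=
  [set z | exists h k, [/\ h \in H, k \in H & z = (h * x * k)%g]].

Definition conj_set (x : G) : set G := [set (x * h * x^-1)%g | h in [set` H]].

Definition hecke_pair : Prop :=
  forall x, exists s : seq G, dcoset x = \bigcup_(y in [set` s]) lcoset y.

Definition reduced_pair : Prop :=
  \bigcap_(x in [set: G]) conj_set x = [set 1%g].

Definition dirT : set G := [set t | [set` H] `<=` conj_set t].

Definition directed_pair : Prop :=
  forall x, exists s t, [/\ dirT s, dirT t & x = (s^-1 * t)%g].

Definition cosets : Type := range lcoset.

HB.instance Definition _ := Choice.on cosets.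

Lemma theta_subproof (x : G) (C : cosets) :
  [set (x * y)%g | y in val C] \in range lcoset.
Proof.
case: C => C /= /set_mem [z _ <-]; apply/mem_set; exists (x * z)%g => //.
apply/seteqP; split=> [_ [h Hh <-]|_ [_ [h Hh <-] <-]].
  by exists (z * h)%g; [exists h|rewrite mulgA].
by exists h => //; rewrite mulgA.
Qed.

Definition cosetMap : topologicalType :=
  {ptws cosets -> discrete_topology cosets}.

Definition theta (x : G) : cosetMap := fun C =>
  exist (fun D : set G => D \in range lcoset) _ (theta_subproof x C).

Definition Gbar : Type := closure (range theta).

HB.instance Definition _ := Choice.on Gbar.
HB.instance Definition _ := Topological.on Gbar.

Definition Gbar_fun (x : Gbar) : cosetMap := val x.

Definition Hbar : set Gbar :=
  [set x | closure (theta @` [set` H]) (Gbar_fun x)].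

Lemma Gbar_theta_subproof (x : G) : theta x \in closure (range theta).
Proof. by apply/mem_set/subset_closure; exists x. Qed.

Definition Gbar_theta (x : G) : Gbar :=
  exist (fun f : cosetMap => f \in closure (range theta)) _
    (Gbar_theta_subproof x).

Definition gone : Gbar := Gbar_theta 1%g.

HB.instance Definition _ := isPointed.Build Gbar gone.

Lemma cosetMap_continuous (T : topologicalType) (F : T -> cosetMap) :
  (forall C, continuous (fun f => F f C : discrete_topology cosets)) ->
  continuous F.
Proof.
move=> cF f; apply/cvg_sup => C; move: f.
exact: (@continuous_comp_initial _ _ _
  (fun g : forall _ : cosets, discrete_topology cosets => g C) F (cF C)).
Qed.

Lemma eval_continuous (C : cosets) :
  continuous (fun f : cosetMap => f C : discrete_topology cosets).
Proof. exact: (@proj_continuous _ (fun=> discrete_topology cosets)). Qed.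

Lemma closure_map (F : cosetMap -> cosetMap) (A : set cosetMap) (f : cosetMap) :
  continuous F -> closure A f -> closure (F @` A) (F f).
Proof.
move=> cF clAf B /cF /clAf [g [Ag Bg]].
by exists (F g); split=> //; exists g.
Qed.

Lemma theta_comp x y : theta x \o theta y = theta (x * y)%g.
Proof.
apply/funext => C; apply: val_inj; apply/seteqP; split.
  by move=> _ [_ [z Cz <-] <-]; exists z; rewrite ?mulgA.
by move=> _ [z Cz <-]; exists (y * z)%g; [exists z|rewrite mulgA].
Qed.

Lemma gmul_subproof (f g : Gbar) :
  (Gbar_fun f \o Gbar_fun g : cosetMap) \in closure (range theta).
Proof.
have /set_mem clf : Gbar_fun f \in closure (range theta) := valP f.
have /set_mem clg : Gbar_fun g \in closure (range theta) := valP g.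
have lcont x : continuous (fun k : cosetMap => (theta x \o k : cosetMap)).
  apply: cosetMap_continuous => C k; apply: continuous_comp.
    exact: eval_continuous.
  move=> B; rewrite /nbhs /= => /principal_filterP tB.
  exact/principal_filterP.
have rcont k : continuous (fun f : cosetMap => (f \o k : cosetMap)).
  by apply: cosetMap_continuous => C; exact: eval_continuous.
apply/mem_set; rewrite ((closure_id _).1 (@closed_closure _ (range theta))).
have := closure_map (rcont (Gbar_fun g)) clf.
apply: closure_subset => _ [_ [x _ <-] <-].
have := closure_map (lcont x) clg.
apply: closure_subset => _ [_ [y _ <-] <-].
by exists (x * y)%g; rewrite ?theta_comp.
Qed.

Definition gmul (f g : Gbar) : Gbar :=
  exist (fun k : cosetMap => k \in closure (range theta)) _
    (gmul_subproof f g).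

(* For a Hecke pair every element of [Gbar] is a bijection whose inverse lies
   in [Gbar], so the default value of [xget] is never used. *)
Definition ginv (f : Gbar) : Gbar :=
  xget f [set g | gmul f g = gone /\ gmul g f = gone].

End HeckePair.

Arguments Hbar {G} H.

Notation borelGbar H := (g_sigma_algebraType (@open (Gbar H))).

(* [mu] is a left Haar (i.e. left invariant Radon) measure with
   [mu (Hbar H) = 1]. *)
Definition left_haar (R : realType) (G : groupType) (H : groupClosed G)
    (mu : {measure set (borelGbar H) -> \bar R}) : Prop :=
  [/\ forall (x : Gbar H) (E : set (borelGbar H)),
        measurable E -> mu (gmul x @` E) = mu E,
      forall K : set (Gbar H), compact K -> (mu K < +oo)%E,
      forall E : set (borelGbar H), measurable E ->
        mu E = ereal_inf [set mu U | U in
                 [set U : set (Gbar H) | open U /\ E `<=` U]],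
      forall U : set (Gbar H), open U ->
        mu U = ereal_sup [set mu K | K in
                 [set K : set (Gbar H) | compact K /\ K `<=` U]]
    & mu (Hbar H) = 1%E].

Definition modular_function (R : realType) (G : groupType)
    (H : groupClosed G) (mu : {measure set (borelGbar H) -> \bar R})
    (Delta : Gbar H -> R) : Prop :=
  forall x : Gbar H, 0 < Delta x /\
    forall E : set (borelGbar H), measurable E ->
      mu ((fun y : Gbar H => gmul y x) @` E) = ((Delta x)%:E * mu E)%E.

Section Convolution.
Variables (R : realType) (G : groupType) (H : groupClosed G).
Variable mu : {measure set (borelGbar H) -> \bar R}.
Variable Delta : Gbar H -> R.

Definition cintegral (f : Gbar H -> R[i]^o) : R[i]^o :=
  (\int[mu]_x complex.Re (f x)) +i* (\int[mu]_x complex.Im (f x)).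

Definition Cc : set (Gbar H -> R[i]^o) :=
  [set f | continuous f /\ compact (closure [set x | f x != 0])].

Definition convol (f g : Gbar H -> R[i]^o) : Gbar H -> R[i]^o :=
  fun x => cintegral (fun y => f y * g (gmul (ginv y) x)).

Definition invol (f : Gbar H -> R[i]^o) : Gbar H -> R[i]^o :=
  fun x => (f (ginv x))^* * (Delta (ginv x))%:C.

Definition projH : Gbar H -> R[i]^o := \1_(Hbar H).

Definition Ccp : set (Gbar H -> R[i]^o) := [set convol f projH | f in Cc].

Definition hecke_algebra : set (Gbar H -> R[i]^o) :=
  [set convol (convol projH f) projH | f in Cc].

End Convolution.

Arguments projH R {G} H.

(* Inner products are linear in the first variable. *)
Record hilbertSpace (R : realType) := HilbertSpace {
  hilbert_carrier :> completeNormedModType R[i] ;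
  hdot : {dot hilbert_carrier for Num.conj} ;
  hdot_norm : forall v, hdot v v = `|v| ^+ 2 }.

Arguments hdot {R} h.

(* C*-algebras are not assumed to be unital. *)
Record cstarAlgebra (R : realType) := CstarAlgebra {
  cstar_carrier :> completeNormedModType R[i] ;
  cmul : cstar_carrier -> cstar_carrier -> cstar_carrier ;
  cstar : cstar_carrier -> cstar_carrier ;
  cmulA : associative cmul ;
  cmul_linearl : forall y, linear (cmul^~ y) ;
  cmul_linearr : forall x, linear (cmul x) ;
  cstar_conj_linear : forall (a : R[i]) x y,
    cstar (a *: x + y) = a^* *: cstar x + cstar y ;
  cstarK : involutive cstar ;
  cstarM : forall x y, cstar (cmul x y) = cmul (cstar y) (cstar x) ;
  cnormM : forall x y, `|cmul x y| <= `|x| * `|y| ;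
  cnorm_star : forall x, `|cmul (cstar x) x| = `|x| ^+ 2 }.

(* [D] is a *-subalgebra of [E] for the operations [mul] and [star], and [pi]
   restricts to a *-representation of [D] by bounded operators on [K]; the
   values of [pi] outside [D] are irrelevant. *)
Definition star_rep (R : realType) (E : lmodType R[i]) (mul : E -> E -> E)
    (star : E -> E) (D : set E) (K : hilbertSpace R)
    (pi : E -> {linear K -> K}) : Prop :=
  [/\ forall f, D f -> continuous (pi f),
      forall (a : R[i]) f g, D f -> D g ->
        forall v, pi (a *: f + g) v = a *: pi f v + pi g v,
      forall f g, D f -> D g -> forall v, pi (mul f g) v = pi f (pi g v)
    & forall f, D f -> forall v w,
        hdot K (pi f v) w = hdot K v (pi (star f) w)].

Definition unitary_rep (R : realType) (G : groupType) (H : groupClosed G)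
    (K : hilbertSpace R) (U : Gbar H -> {linear K -> K}) : Prop :=
  [/\ forall v, U (gone H) v = v,
      forall x y v, U (gmul x y) v = U x (U y v),
      forall x v w, hdot K (U x v) (U x w) = hdot K v w
    & forall v, continuous (fun x => U x v)].

(* The integrated form [U(f)] of a unitary representation [U] is the bounded
   operator given weakly by [<U(f) v, w> = \int f(x) <U_x v, w> dx]. *)
Definition integrated_form (R : realType) (G : groupType)
    (H : groupClosed G) (mu : {measure set (borelGbar H) -> \bar R})
    (K : hilbertSpace R) (U : Gbar H -> {linear K -> K})
    (f : Gbar H -> R[i]^o) (v w : K) : R[i]^o :=
  cintegral mu (fun x => f x * hdot K (U x v) w).

(* The operator norms [||U(f)||] are the suprema of [|<U(f) v, w>|] over [v]
   and [w] in the unit ball; the C*-norm of [f] is the supremum of [||U(f)||]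
   over all unitary representations [U]. *)
Definition full_norm_set (R : realType) (G : groupType)
    (H : groupClosed G) (mu : {measure set (borelGbar H) -> \bar R})
    (f : Gbar H -> R[i]^o) : set R[i] :=
  [set r | exists (K : hilbertSpace R) (U : Gbar H -> {linear K -> K})
             (v w : K),
      [/\ unitary_rep U, `|v| <= 1, `|w| <= 1
        & r = `|integrated_form mu U f v w|]].

(* [A] is the completion of [Cc] in the full C*-norm, and [iota] is the
   canonical map from [Cc] to [A]; its values outside [Cc] are irrelevant. *)
Definition full_group_cstar (R : realType) (G : groupType)
    (H : groupClosed G) (mu : {measure set (borelGbar H) -> \bar R})
    (Delta : Gbar H -> R) (A : cstarAlgebra R)
    (iota : (Gbar H -> R[i]^o) -> A) : Prop :=
  [/\ forall (a : R[i]) f g, Cc f -> Cc g ->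
        iota (a *: f + g) = a *: iota f + iota g,
      forall f g, Cc f -> Cc g -> iota (convol mu f g) = cmul (iota f) (iota g),
      forall f, Cc f -> iota (invol Delta f) = cstar (iota f),
      forall f, Cc f -> supremums (full_norm_set mu f) `|iota f|
    & closure (iota @` @Cc R G H) = [set: A]].

Definition corner (R : realType) (A : cstarAlgebra R) (q : A) : set A :=
  [set cmul (cmul q a) q | a in [set: A]].

(* Every *-representation of the *-algebra [D] extends along [iota] to a
   *-representation of [B]. *)
Definition enveloping (R : realType) (E : lmodType R[i]) (mul : E -> E -> E)
    (star : E -> E) (D : set E) (A : cstarAlgebra R) (iota : E -> A)
    (B : set A) : Prop :=
  forall (K : hilbertSpace R) (pi : E -> {linear K -> K}),
    star_rep mul star D pi ->
    exists Pi : A -> {linear K -> K},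
      star_rep (@cmul R A) (@cstar R A) B Pi /\
      forall f, D f -> forall v, Pi (iota f) v = pi f v.

(* Main.v *)
(* Let Hb be the closure of H and T the set of all t in the completion with
   t^-1 Hb t contained in Hb. For t in T one has Hb t Hb = t Hb, so the
   indicator function of the coset t Hb lies in the Hecke algebra. If f is
   right invariant with support in finitely many cosets x_i Hb, directedness
   yields one s in T with all s x_i in T; the left translate g of f by s is in
   the Hecke algebra, and g^* g = f^* f because left translations are unitary.

   Let pi be a *-representation of the Hecke algebra on K. The operators
   V_t = pi(1_{t Hb}), t in T, form a semigroup with V_t^* V_t = pi(p), and they
   dilate to a unitary representation U of the whole group by right translation
   on the Hilbert space of all bounded maps F from the group to K that satisfy
   V_t^* F(t x) = F(x) for t in T; as the group is T^-1 T, this is an inverse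
   limit along a directed set, whose inner product is the limit of
   <F(x), F'(x)>. A vector v of K gives F_v(x) = pi(p * 1_{x Hb}) v, and
   <U(f) F_v, F_w> = <pi(f) v, w> for f in the Hecke algebra. Hence the norm of
   pi(f) is at most that of f in A, and pi extends by density to p A p. *)

Require Import Defs.
From HB Require Import structures.
From mathcomp Require Import all_boot all_order all_algebra.
From mathcomp Require Import complex.
From mathcomp Require Import all_classical all_reals all_analysis.
From mathcomp Require Import measurable_realfun ring lra.

Set Implicit Arguments.
Unset Strict Implicit.
Unset Printing Implicit Defensive.

Import Order.TTheory GRing.Theory Num.Theory.
Import numFieldNormedType.Exports.

Local Open Scope classical_set_scope.
Local Open Scope ring_scope.
Local Open Scope complex_scope.

(* The space of bounded families replaces the completed tensor product that usually carries an
   induced representation: its vectors are honest functions and it is complete as it stands, so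
   nothing is divided out or completed. The price is that strong continuity of [U] is no longer
   visible. It comes from an equality: [V_t] is a partial isometry, so the squared distance from
   [F(t a)] to [V_t F(a)] is exactly [|F(t a)|^2 - |F(a)|^2]. This is small uniformly in [t] once
   [|F(a)|] is close to the norm of [F], while [F(a y)] is locally constant in [y].

   The detour through unitary representations is forced by the C*-norm, which is a supremum over
   them.

   Integrals stay elementary because the cosets [x Hb] are open, compact and of measure 1: right
   invariant functions of compact support are finite combinations of their indicators, and
   convolution of such an indicator with a left invariant function is a left translation. No order
   of integration is ever exchanged. *)
Reserved Notation "x ** y" (at level 40, left associativity).
Local Notation "x ** y" := (gmul x y).

(** * The Schlichting completion as a group *)

Section Completion.
Variables (G : groupType) (H : groupClosed G).
Local Notation Gb := (Gbar H).
Local Notation Hb := (Hbar H).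
Local Notation th := (@theta G H).
Local Notation gth := (@Gbar_theta G H).

Definition coset_of_elt (x : G) : cosets H :=
  exist (fun D : set G => D \in range (lcoset H)) (lcoset H x)
    (mem_set (imageT _ x)).

Lemma coset_of_eltP (C : cosets H) : exists x, C = coset_of_elt x.
Proof. by case: C => C /[dup] /set_mem[x _ <-] p; exists x; apply: val_inj. Qed.

Lemma theta_coset x y : th x (coset_of_elt y) = coset_of_elt (x * y)%g.
Proof.
apply: val_inj; apply/seteqP; split=> [_ [_ [h Hh <-] <-]|_ [h Hh <-]].
  by exists h; rewrite ?mulgA.
by exists (y * h)%g; [exists h|rewrite mulgA].
Qed.

Lemma coset_of_elt_eq x y :
  (coset_of_elt x = coset_of_elt y) <-> (x^-1 * y)%g \in H.
Proof.
split=> [[/seteqP[_ /(_ y)]]|xyH].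
  case; first by exists 1%g; rewrite ?mulg1//= gpred1.
  by move=> h /= hH <-; rewrite mulKg.
apply: val_inj; apply/seteqP; split=> [_ [h hH <-]|_ [h hH <-]] /=.
  exists ((x^-1 * y)^-1 * h)%g; last by rewrite invgM invgK !mulgA mulgV mul1g.
  by rewrite /= gpredM// gpredV.
exists ((x^-1 * y) * h)%g; last by rewrite !mulgA mulgV mul1g.
by rewrite /= gpredM.
Qed.

Local Notation base := (coset_of_elt 1%g).

Lemma Gbar_fun_inj (x y : Gb) :
  (forall C, Gbar_fun x C = Gbar_fun y C) -> x = y.
Proof. by move=> xy; apply: val_inj; apply/funext. Qed.

Lemma val_Gbar_continuous : continuous (@Gbar_fun G H).
Proof. exact: initial_continuous. Qed.

Lemma open_eval_map (C D : cosets H) : open [set f : cosetMap H | f C = D].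
Proof.
have /continuousP/(_ [set D : discrete_topology (cosets H)]) := @Defs.eval_continuous G H C.
by apply; exact: discrete_open.
Qed.

Lemma open_eval (C D : cosets H) : open [set x : Gb | Gbar_fun x C = D].
Proof.
have /continuousP/(_ _ (open_eval_map C D)) := val_Gbar_continuous.
by [].
Qed.

Lemma continuous_Gbar (T : topologicalType) (F : T -> Gb) :
  (forall C D, open [set t | Gbar_fun (F t) C = D]) -> continuous F.
Proof.
move=> oF; apply/(continuous_comp_initial (w := @Gbar_fun G H)).
apply: cosetMap_continuous => C; apply/continuousP => A _.
rewrite (_ : _ @^-1` A = \bigcup_(D in A) [set t | Gbar_fun (F t) C = D]).
  by apply: bigcup_open => D _; exact: oF.
by apply/seteqP; split=> [t ?|t [D AD /= tD]]; [exists (Gbar_fun (F t) C)|rewrite -tD in AD].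
Qed.

Lemma gmulA : associative (@gmul G H).
Proof. by move=> x y z; apply: val_inj. Qed.

Lemma Gbar_funM (x y : Gb) C :
  Gbar_fun (x ** y) C = Gbar_fun x (Gbar_fun y C).
Proof. by []. Qed.

Lemma Gbar_fun_theta g C : Gbar_fun (gth g) C = th g C.
Proof. by []. Qed.

Lemma Gbar_fun1 C : Gbar_fun (gone H) C = C.
Proof.
by have [c ->] := coset_of_eltP C; rewrite Gbar_fun_theta theta_coset mul1g.
Qed.

Lemma gmul1g : left_id (gone H) (@gmul G H).
Proof. by move=> x; apply: Gbar_fun_inj => C; rewrite Gbar_funM Gbar_fun1. Qed.

Lemma gmulg1 : right_id (gone H) (@gmul G H).
Proof. by move=> x; apply: Gbar_fun_inj => C; rewrite Gbar_funM Gbar_fun1. Qed.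

Lemma Gbar_thetaM x y :
  gth (x * y)%g = gth x ** gth y.
Proof. by apply: val_inj; rewrite /= theta_comp. Qed.

Lemma gmulr_continuous (x : Gb) : continuous (fun y => y ** x).
Proof. by apply: continuous_Gbar => C D; exact: open_eval. Qed.

Lemma gmull_continuous (x : Gb) : continuous (fun y => x ** y).
Proof.
apply: continuous_Gbar => C D.
rewrite (_ : [set t | _] = \bigcup_(E in [set E | Gbar_fun x E = D])
   [set t : Gb | Gbar_fun t C = E]).
  by apply: bigcup_open => E _; exact: open_eval.
by apply/seteqP; split=> [t /= <-|t /= [E /= xE tE]];
  [exists (Gbar_fun t C)|rewrite -xE -tE].
Qed.

Lemma Gbar_approx (x : Gb) (C : cosets H) :
  exists g, Gbar_fun x C = th g C.
Proof.
have /set_mem : Gbar_fun x \in closure (range (th)) := valP x.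
have /open_nbhs_nbhs : open_nbhs (Gbar_fun x)
  [set f : cosetMap H | f C = Gbar_fun x C].
  by split=> //; exact: open_eval_map.
by move=> /[swap] /[apply] -[_ [[g _ <-] /= <-]]; exists g.
Qed.

(** Near [x] there are elements of [G] that agree with [x] at the base coset, and an element of [G]
    fixes that coset exactly when it lies in [H]. As a stabiliser, [Hb] is visibly open and closed
    under products. *)
Lemma HbarE : Hb = [set x | Gbar_fun x base = base].
Proof.
apply/seteqP; split=> [x xH|x xH].
  have /open_nbhs_nbhs : open_nbhs (Gbar_fun x)
      [set f : cosetMap H | f base = Gbar_fun x base].
    by split=> //; exact: open_eval_map.
  move=> /xH [_ [[h hH <-] /= <-]]; rewrite theta_coset; apply/coset_of_elt_eq.
  by rewrite !mulg1 gpredV.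
move=> B Bx; have /set_mem clx : Gbar_fun x \in closure (range (th)) := valP x.
have /(filterI Bx)/clx[_ [[g _ <-] [Bg /= gH]]] :
    nbhs (Gbar_fun x) [set f : cosetMap H | f base = base].
  by apply: open_nbhs_nbhs; split=> //; exact: open_eval_map.
exists (th g); split=> //; exists g => //=.
by move: gH; rewrite theta_coset mulg1 => /esym/coset_of_elt_eq; rewrite invg1 mul1g.
Qed.

Lemma open_Hbar : open Hb.
Proof. by rewrite HbarE; exact: open_eval. Qed.

Lemma gone_Hbar : Hb (gone H).
Proof. by rewrite HbarE /= Gbar_fun1. Qed.

Lemma gmul_Hbar x y : Hb x -> Hb y -> Hb (x ** y).
Proof. by rewrite HbarE /= => xH yH; rewrite Gbar_funM yH. Qed.

Hypothesis hecke : hecke_pair H.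

(** The orbit of [xH] under [H] consists of the left cosets inside [HxH]; in this form the Hecke
    condition yields compactness. *)
Lemma finite_orbit (C : cosets H) :
  finite_set [set th h C | h in [set` H]].
Proof.
have [x ->] := coset_of_eltP C; have [s Hs] := hecke x.
apply: (@sub_finite_set _ _ [set coset_of_elt y | y in [set` s]]); last first.
  by apply: finite_image; exact: finite_seq.
move=> _ [h hH <-]; rewrite theta_coset.
have : dcoset H x (h * x)%g by exists h, 1%g; rewrite mulg1 gpred1.
rewrite Hs => -[y ys [k kH ykhx]]; exists y => //.
by apply/coset_of_elt_eq; rewrite -ykhx mulKg.
Qed.

(** Maps in the closure send each coset into its finite [H]-orbit, so Tychonoff applies to the
    product of the orbits. *)
Lemma compact_closure_theta : compact (closure (th @` [set` H])).
Proof.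
pose A C := [set th h C | h in [set` H]] : set (discrete_topology (cosets H)).
pose P : set (cosetMap H) := [set f | forall C, A C (f C)].
have cP : compact P.
  by apply: (@tychonoff _ (fun=> discrete_topology (cosets H)) A) => C;
    apply: finite_compact; exact: finite_orbit.
apply: (subclosed_compact _ cP); first exact: closed_closure.
move=> f clf C; have /open_nbhs_nbhs : open_nbhs f
    [set k : cosetMap H | k C = f C].
  by split=> //; exact: open_eval_map.
by move=> /clf [_ [[h hH <-] /= <-]]; exists h.
Qed.

Lemma compact_Hbar : compact Hb.
Proof.
move=> F FF FH.
have /compact_closure_theta [f [Hf clf]] : (@Gbar_fun G H @ F) (closure (th @` [set` H])).
  exact: FH.
have fG : (f : cosetMap H) \in closure (range (th)).
  apply/mem_set; apply: closure_subset Hf => _ [h _ <-]; by exists h.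
exists (exist (fun f : cosetMap H => f \in closure (range (th))) f fG).
split=> //= A B FA; rewrite nbhsE => -[_ [[B' oB' <-] /= B'f] sB].
have FA' : (@Gbar_fun G H @ F) (@Gbar_fun G H @` A).
  by apply: (@filterS _ F _ A) => // x Ax; exists x.
have [_ [[x Ax <-] B'x]] := clf _ _ FA' (open_nbhs_nbhs (conj oB' B'f)).
by exists x; split=> //; exact: sB.
Qed.

(* A cluster point of [theta h^-1], as [theta h] tends to [x], in the compact
   closure of [th]. *)
Lemma Hbar_inverse (x : Gb) : Hb x ->
  exists2 y, Hb y & gmul x y = gone H /\ gmul y x = gone H.
Proof.
move=> xH.
pose F : set_system G := [set A | exists2 B, nbhs (Gbar_fun x) B &
  [set h | h \in H /\ B (th h)] `<=` A].
have FF : ProperFilter F.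
  split.
    case=> B /xH [_ [[h hH <-] Bh]]; by move=> /(_ h); apply.
  split.
  - by exists setT => //; exact: filterT.
  - move=> A A' [B nB BA] [B' nB' BA']; exists (B `&` B'); first exact: filterI.
    by move=> h [hH [Bh B'h]]; split; [exact: BA|exact: BA'].
  - by move=> A A' AA' [B nB BA]; exists B => //; exact: subset_trans AA'.
have FH : ((fun h => th h^-1) @ F : set_system (cosetMap H))
    (closure (th @` [set` H])).
  exists setT; first exact: filterT.
  by move=> h [hH _]; apply: subset_closure; exists h^-1%g => //=; rewrite gpredV.
have [y [yH cly]] := compact_closure_theta _ FH.
have yG : (y : cosetMap H) \in closure (range (th)).
  by apply/mem_set; apply: closure_subset yH => _ [h _ <-]; exists h.
pose y' : Gb := exist (fun f : cosetMap H => f \in closure (range (th))) y yG.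
(* Each identity to be proved, evaluated at one coset, involves one value of [x] and one of [y]; a
   single [h] that realises both reduces it to a cancellation of [h] and [h^-1] in [G]. *)
have approx C D : exists h, [/\ Gbar_fun x C = th h C,
    y D = th h^-1%g D & h \in H].
  have oC : nbhs (Gbar_fun x) [set f : cosetMap H | f C = Gbar_fun x C].
    by apply: open_nbhs_nbhs; split=> //; exact: open_eval_map.
  have oD : nbhs y [set f : cosetMap H | f D = y D].
    by apply: open_nbhs_nbhs; split=> //; exact: open_eval_map.
  have FC : ((fun h => th h^-1) @ F : set_system (cosetMap H))
      [set th h^-1 | h in
        [set h | h \in H /\ th h C = Gbar_fun x C]].
    exists [set f : cosetMap H | f C = Gbar_fun x C] => //.
    by move=> h [hH hC]; exists h.
  by have [_ [[h [hH hC] <-] /= <-]] := cly _ _ FC oD; exists h.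
have Ey C : Gbar_fun y' C = y C by [].
exists y' => //; split; apply: Gbar_fun_inj => C; rewrite Gbar_funM Gbar_fun1.
  have [h [xh yh _]] := approx (y C) C; have [c Ce] := coset_of_eltP C.
  by rewrite Ey xh yh Ce !theta_coset mulVKg.
have [h [xh yh _]] := approx C (Gbar_fun x C); have [c Ce] := coset_of_eltP C.
by rewrite Ey yh xh Ce !theta_coset mulKg.
Qed.

(** [g] moves the base coset as [x] does, so [g^-1 x] stabilises it. *)
Lemma Gbar_decomp (x : Gb) : exists g k, Hb k /\ x = gth g ** k.
Proof.
have [g xg] := Gbar_approx x base.
exists g, (gth g^-1 ** x); split; last first.
  by rewrite gmulA -Gbar_thetaM mulgV gmul1g.
by rewrite HbarE /= Gbar_funM xg Gbar_fun_theta !theta_coset mulKg.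
Qed.

Lemma Gbar_inverse (x : Gb) :
  exists y, gmul x y = gone H /\ gmul y x = gone H.
Proof.
have [g [k [kH ->]]] := Gbar_decomp x; have [l _ [kl lk]] := Hbar_inverse kH.
exists (l ** gth g^-1); split.
  by rewrite gmulA -(gmulA _ k) kl gmulg1 -Gbar_thetaM mulgV.
by rewrite gmulA -(gmulA l) -Gbar_thetaM mulVg gmulg1.
Qed.

Lemma ginvP (x : Gb) : x ** ginv x = gone H /\ ginv x ** x = gone H.
Proof.
have [y xy] := Gbar_inverse x.
exact: (@xgetI _ x [set g | x ** g = gone H /\ g ** x = gone H] y xy).
Qed.

Lemma gmulgV (x : Gb) : x ** ginv x = gone H.
Proof. by have [] := ginvP x. Qed.

Lemma gmulVg (x : Gb) : ginv x ** x = gone H.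
Proof. by have [] := ginvP x. Qed.

Lemma gmulKg (x y : Gb) : ginv x ** (x ** y) = y.
Proof. by rewrite gmulA gmulVg gmul1g. Qed.

Lemma gmulVKg (x y : Gb) : x ** (ginv x ** y) = y.
Proof. by rewrite gmulA gmulgV gmul1g. Qed.

Lemma gmulgK (x y : Gb) : y ** x ** ginv x = y.
Proof. by rewrite -gmulA gmulgV gmulg1. Qed.

Lemma gmulgKV (x y : Gb) : y ** ginv x ** x = y.
Proof. by rewrite -gmulA gmulVg gmulg1. Qed.

Lemma ginv_uniq (x y : Gb) : x ** y = gone H -> ginv x = y.
Proof. by move=> xy; rewrite -[y](gmulKg x) xy gmulg1. Qed.

Lemma ginvK : involutive (@ginv G H).
Proof. by move=> x; apply: ginv_uniq; exact: gmulVg. Qed.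

Lemma ginvM (x y : Gb) : ginv (x ** y) = ginv y ** ginv x.
Proof. by apply: ginv_uniq; rewrite gmulA gmulgK gmulgV. Qed.

Lemma ginv1 : ginv (gone H) = gone H.
Proof. by apply: ginv_uniq; rewrite gmul1g. Qed.

Lemma ginv_Hbar (x : Gb) : Hb x -> Hb (ginv x).
Proof. by move=> /Hbar_inverse[y yH [/ginv_uniq-> _]]. Qed.

Lemma ginv_continuous : continuous (@ginv G H).
Proof.
apply: continuous_Gbar => C D.
(* The inverse of [x] sends [C] to [D] exactly when [x] sends [D] to [C]. *)
rewrite (_ : [set t | _] = [set x : Gb | Gbar_fun x D = C]).
  exact: open_eval.
apply/seteqP; split=> x /= <-; rewrite -Gbar_funM.
  by rewrite gmulgV Gbar_fun1.
by rewrite gmulVg Gbar_fun1.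
Qed.

End Completion.

(** * Integrals under maps that scale the measure *)

(** [fine] is 0 at both infinities and a positive factor preserves them, so the identity survives
    infinite values. Real integrals therefore scale without any integrability assumption. *)
Lemma fine_gt0ZB (R : realDomainType) (c : R) (a b : \bar R) :
  0 < c -> (0 <= a)%E -> (0 <= b)%E ->
  fine (c%:E * a - c%:E * b)%E = c * fine (a - b)%E.
Proof.
move=> c_gt0; case: a b => [a| |] [b| |] // _ _.
- by rewrite /= mulrBr.
- by rewrite /= !gt0_muley ?lte_fin//= mulr0.
- by rewrite /= !gt0_muley ?lte_fin//= mulr0.
- by rewrite /= !gt0_muley ?lte_fin//= mulr0.
Qed.

Section ChangeOfVariables.
Context d (T : measurableType d) (R : realType).
Variable mu : {measure set T -> \bar R}.
Variables (phi : T -> T) (c : R).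
Hypotheses (mphi : measurable_fun setT phi) (c_gt0 : 0 < c).
Hypothesis phi_mu :
  forall E, measurable E -> mu (phi @^-1` E) = (c%:E * mu E)%E.

Lemma ge0_integral_scaling (f : T -> \bar R) : measurable_fun setT f ->
  (forall x, 0 <= f x)%E ->
  (\int[mu]_x f (phi x) = c%:E * \int[mu]_x f x)%E.
Proof.
move=> mf f0; have c0 : 0 <= c by exact: ltW.
rewrite -[LHS](@ge0_integral_pushforward _ _ _ _ _ _ mphi mu setT)//.
rewrite -(@ge0_integral_mscale _ _ _ _ setT _ (NngNum c0))//.
by apply: eq_measure_integral => A mA _; exact: phi_mu.
Qed.

Lemma Rintegral_scaling (f : T -> R) : measurable_fun setT f ->
  \int[mu]_x f (phi x) = c * \int[mu]_x f x.
Proof.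
move=> mf; rewrite /Rintegral.
have mEf : measurable_fun setT (EFin \o f) by exact/measurable_EFinP.
rewrite (integralE mu setT (fun x => (f (phi x))%:E)).
rewrite (integralE mu setT (fun x => (f x)%:E)).
have -> : ((fun x => (f (phi x))%:E)^\+ = (EFin \o f)^\+ \o phi)%E.
  by apply/funext => x; rewrite /= unlock.
have -> : ((fun x => (f (phi x))%:E)^\- = (EFin \o f)^\- \o phi)%E.
  by apply/funext => x; rewrite /= unlock.
rewrite (ge0_integral_scaling (measurable_funepos mEf) (funepos_ge0 _)).
rewrite (ge0_integral_scaling (measurable_funeneg mEf) (funeneg_ge0 _)).
by rewrite fine_gt0ZB// integral_ge0.
Qed.

End ChangeOfVariables.

Lemma Rintegral_gt0Zl d (T : measurableType d) (R : realType)
    (mu : {measure set T -> \bar R}) (c : R) (f : T -> R) :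
  0 < c -> measurable_fun setT f -> \int[mu]_x (c * f x) = c * \int[mu]_x f x.
Proof.
move=> c0 mf; rewrite /Rintegral.
have mEf : measurable_fun setT (EFin \o f) by exact/measurable_EFinP.
rewrite (integralE mu setT (fun x => (c * f x)%:E)).
rewrite (integralE mu setT (fun x => (f x)%:E)).
have -> : ((fun x => (c * f x)%:E)^\+ = fun x => c%:E * (EFin \o f)^\+ x)%E.
  by rewrite -ge0_funeposM// ltW.
have -> : ((fun x => (c * f x)%:E)^\- = fun x => c%:E * (EFin \o f)^\- x)%E.
  by rewrite -ge0_funenegM// ltW.
rewrite !ge0_integralZl ?lee_fin ?(ltW c0)//;
  [|exact: measurable_funeneg|exact: measurable_funepos].
by rewrite fine_gt0ZB// integral_ge0.
Qed.

(** * Functions invariant under translations by the compact open subgroup *)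

Section Invariance.
Variables (G : groupType) (H : groupClosed G).
Local Notation Gb := (Gbar H).
Local Notation Hb := (Hbar H).
Hypothesis hecke : hecke_pair H.

Definition hcoset (x : Gb) : set Gb := [set y | Hb (ginv x ** y)].

Lemma hcoset_refl x : hcoset x x.
Proof. by rewrite /hcoset/= (gmulVg hecke); exact: gone_Hbar. Qed.

Lemma hcoset_sym x y : hcoset x y -> hcoset y x.
Proof.
by move=> /(ginv_Hbar hecke); rewrite (ginvM hecke) (ginvK hecke).
Qed.

Lemma hcoset_trans x y z : hcoset x y -> hcoset y z -> hcoset x z.
Proof.
move=> /gmul_Hbar/[apply]; rewrite /hcoset/= gmulA.
by rewrite (gmulgK hecke).
Qed.

Lemma hcosetMr x y h : Hb h -> hcoset x (y ** h) = hcoset x y.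
Proof.
move=> hH; apply/propext; rewrite /hcoset/= gmulA; split; last first.
  by move/gmul_Hbar; exact.
move=> /gmul_Hbar/(_ (ginv_Hbar hecke hH)).
by rewrite (gmulgK hecke).
Qed.

Lemma hcosetMl a x y : hcoset (a ** x) (a ** y) = hcoset x y.
Proof. by rewrite /hcoset/= (ginvM hecke) -gmulA (gmulKg hecke). Qed.

Lemma hcoset1 : hcoset (gone H) = Hb.
Proof. by apply/seteqP; split=> x; rewrite /hcoset/= (ginv1 hecke) gmul1g. Qed.

Lemma hcosetE x : hcoset x = [set x ** h | h in Hb].
Proof.
apply/seteqP; split=> [y xy|_ [h hH <-]].
  by exists (ginv x ** y) => //; rewrite (gmulVKg hecke).
by rewrite /hcoset/= (gmulKg hecke).
Qed.

Lemma open_hcoset x : open (hcoset x).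
Proof.
have /continuousP := @gmull_continuous _ H (ginv x).
by apply; exact: open_Hbar.
Qed.

Lemma closed_hcoset x : closed (hcoset x).
Proof.
rewrite -[hcoset x]setCK; apply: open_closedC.
rewrite (_ : ~` _ = \bigcup_(y in ~` hcoset x) hcoset y).
  by apply: bigcup_open => y _; exact: open_hcoset.
apply/seteqP; split=> [y xy|y [z xz zy] xy].
  by exists y => //; exact: hcoset_refl.
by apply: xz; apply: hcoset_trans xy _; exact: hcoset_sym.
Qed.

Lemma compact_hcoset x : compact (hcoset x).
Proof.
rewrite hcosetE; apply: continuous_compact; last exact: compact_Hbar.
by apply: continuous_subspaceT; exact: gmull_continuous.
Qed.

Definition hcosets (s : seq Gb) : set Gb :=
  [set x | exists2 y, y \in s & hcoset y x].

Lemma hcosets_cons x s : hcosets (x :: s) = hcoset x `|` hcosets s.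
Proof.
apply/seteqP; split=> y; last first.
  case=> [xy|[z zs zy]]; first by exists x; rewrite ?mem_head.
  by exists z; rewrite // inE zs orbT.
by case=> z; rewrite inE => /orP[/eqP->|zs zy]; [left|right; exists z].
Qed.

Lemma hcosets0 : hcosets [::] = set0.
Proof. by apply/seteqP; split=> // x []. Qed.

Lemma hcosets_cat s t : hcosets (s ++ t) = hcosets s `|` hcosets t.
Proof.
elim: s => [|x s IH]; first by rewrite hcosets0 set0U.
by rewrite cat_cons !hcosets_cons IH setUA.
Qed.

Lemma hcosets_compact s : compact (hcosets s).
Proof.
elim: s => [|x s IH]; first by rewrite hcosets0; exact: compact0.
by rewrite hcosets_cons; apply: compactU => //; exact: compact_hcoset.
Qed.

Lemma hcosets_closed s : closed (hcosets s).
Proof.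
elim: s => [|x s IH]; first by rewrite hcosets0; exact: closed0.
by rewrite hcosets_cons; apply: closedU => //; exact: closed_hcoset.
Qed.

Lemma compact_hcosets (K : set Gb) : compact K -> exists s, K `<=` hcosets s.
Proof.
rewrite compact_cover => /(_ _ setT hcoset).
case=> [x _|x _|D _ KD]; [exact: open_hcoset|by exists x => //; exact: hcoset_refl|].
by exists (finmap.enum_fset D) => x /KD[y yD yx]; exists y.
Qed.

(** [Hb y] is compact, hence covered by finitely many left cosets: the Hecke condition for the
    completed pair. It keeps the supports of convolutions and adjoints finite. *)
Lemma Hbar_mul_hcosets s : exists t, forall h x, Hb h -> hcosets s x ->
  hcosets t (h ** x).
Proof.
elim: s => [|y s [t ht]]; first by exists [::] => h x _; rewrite hcosets0.
have [u hu] : exists u, [set h ** y | h in Hb] `<=` hcosets u.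
  apply: compact_hcosets; apply: continuous_compact; last exact: compact_Hbar.
  by apply: continuous_subspaceT; exact: gmulr_continuous.
exists (u ++ t) => h x hH; rewrite hcosets_cat hcosets_cons => -[yx|sx].
  left; have [z zu zhy] := hu (h ** y) (imageP _ hH).
  by exists z => //; apply: hcoset_trans zhy _; rewrite hcosetMl.
by right; exact: ht.
Qed.

Definition left_invariant (T : Type) (f : Gb -> T) :=
  forall h x, Hb h -> f (h ** x) = f x.

Definition right_invariant (T : Type) (f : Gb -> T) :=
  forall x h, Hb h -> f (x ** h) = f x.

Lemma right_invariant_hcoset T (f : Gb -> T) x y :
  right_invariant f -> hcoset x y -> f y = f x.
Proof. by move=> fr; rewrite hcosetE => -[h hH <-]; exact: fr. Qed.

Lemma right_invariant_continuous (T : topologicalType) (f : Gb -> T) :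
  right_invariant f -> continuous f.
Proof.
move=> fr; apply/continuousP => A _.
rewrite (_ : f @^-1` A = \bigcup_(y in f @^-1` A) hcoset y).
  by apply: bigcup_open => y _; exact: open_hcoset.
apply/seteqP; split=> [y Ay|y [z Az zy]]; first by exists y => //; exact: hcoset_refl.
by rewrite /preimage/= (right_invariant_hcoset fr zy).
Qed.

Lemma left_invariant_continuous (T : topologicalType) (f : Gb -> T) :
  left_invariant f -> continuous f.
Proof.
move=> fl; have gc : continuous (f \o @ginv G H).
  apply: right_invariant_continuous => x h hH /=.
  by rewrite (ginvM hecke) fl//; exact: ginv_Hbar.
rewrite (_ : f = (f \o @ginv G H) \o @ginv G H); last first.
  by apply/funext => x /=; rewrite (ginvK hecke).
by move=> x; apply: continuous_comp; [exact: ginv_continuous|exact: gc].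
Qed.

Variable R : realType.
Implicit Types f g : Gb -> R[i]^o.

(** Compact support in terms of cosets; for continuous functions the two notions agree. *)
Definition coset_finite f := exists s, forall x, f x != 0 -> hcosets s x.

Lemma coset_finite_Cc f : continuous f -> coset_finite f -> Cc f.
Proof.
move=> fc [s fs]; split=> //; apply: (subclosed_compact _ (@hcosets_compact s)).
  exact: closed_closure.
by rewrite [X in _ `<=` X]((closure_id _).1 (@hcosets_closed s)); exact: closure_subset.
Qed.

Lemma Cc_coset_finite f : Cc f -> coset_finite f.
Proof.
move=> [_ /compact_hcosets[s fs]]; exists s => x fx.
by apply: fs; exact: subset_closure.
Qed.

Definition chi (x : Gb) : Gb -> R[i]^o := \1_(hcoset x).

Lemma chi1 : chi (gone H) = projH R H.
Proof. by rewrite /chi hcoset1. Qed.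

Lemma chi_right_invariant x : right_invariant (chi x).
Proof.
move=> y h hH; rewrite /chi !indicE; congr (nat_of_bool _)%:R.
by apply/idP/idP => /set_mem ?; apply/mem_set; rewrite ?hcosetMr// -1?(hcosetMr x y hH).
Qed.

Lemma chi_coset_finite x : coset_finite (chi x).
Proof.
exists [:: x] => y; rewrite /chi indicE pnatr_eq0 eqb0 negbK => /set_mem xy.
by exists x; rewrite ?mem_head.
Qed.

Lemma right_invariant_ind (P : (Gb -> R[i]^o) -> Prop) :
  P 0 -> (forall c x f, right_invariant f -> coset_finite f ->
    P f -> P (c *: chi x + f)) ->
  forall f, right_invariant f -> coset_finite f -> P f.
Proof.
move=> P0 PD f + [s]; elim: s f => [|x s IH] f fr fs.
  rewrite (_ : f = 0) //; apply/funext => y; apply/eqP; apply: contrapT => /negP.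
  by move/fs => [].
(* [f] is constant on the coset of [x], so subtracting [f x *: chi x] removes that coset from the
   support. *)
rewrite -(subrK (f x *: chi x) f) addrC.
have fr' : right_invariant (f - f x *: chi x).
  by move=> y h hH; rewrite !fctE fr// (chi_right_invariant _ _ hH).
have fs' y : (f - f x *: chi x) y != 0 -> hcosets s y.
  rewrite !fctE /chi indicE /=; case: (pselect (hcoset x y)) => xy.
    by rewrite mem_set//= (right_invariant_hcoset fr xy) scaler1 subrr eqxx.
  rewrite memNset//= scaler0 subr0 => /fs; rewrite hcosets_cons.
  by case.
by apply: PD => //; [exists s|exact: IH].
Qed.

End Invariance.

Arguments chi {G H R} x.

(** * Integrals of complex functions on the completion *)

Section Integral.
Variables (R : realType) (G : groupType) (H : groupClosed G).
Local Notation Gb := (Gbar H).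
Local Notation Hb := (Hbar H).
Hypothesis hecke : hecke_pair H.
Variable mu : {measure set (borelGbar H) -> \bar R}.
Implicit Types F : Gb -> R[i]^o.

Lemma open_measurable_Gbar (A : set Gb) :
  open A -> measurable (A : set (borelGbar H)).
Proof. by move=> oA; exact: sub_sigma_algebra. Qed.

Lemma continuous_measurable_Gbar (phi : Gb -> Gb) : continuous phi ->
  measurable_fun setT (phi : borelGbar H -> borelGbar H).
Proof.
move=> /continuousP cphi.
apply: (@measurability _ _ _ _ _ (phi : borelGbar H -> borelGbar H)
  (@open Gb)) => //.
move=> _ [A oA <-]; rewrite setTI; apply: open_measurable_Gbar; exact: cphi.
Qed.

Lemma lower_semicontinuous_measurable_Gbar (f : Gb -> R) :
  (forall a, open [set x | a < f x]) ->
  measurable_fun setT (f : borelGbar H -> R).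
Proof.
move=> of_; apply: (measurability _ (RGenOInfty.measurableE R)).
move=> _ [_ [a ->] <-]; rewrite setTI; apply: open_measurable_Gbar.
rewrite (_ : _ @^-1` _ = [set x | a < f x])//.
by apply/seteqP; split=> x; rewrite /= in_itv/= andbT.
Qed.

Definition cmeasurable F :=
  measurable_fun setT (@complex.Re R \o F : borelGbar H -> R) /\
  measurable_fun setT (@complex.Im R \o F : borelGbar H -> R).

Lemma Re_le_norm (z : R[i]) : complex.Re z <= complex.Re `|z|.
Proof.
apply: le_trans (ler_norm _) _; rewrite -lecR.
by apply: le_trans (normc_ge_Re z) _; rewrite normc_def.
Qed.

(** One argument for the real and the imaginary part: [L] respects differences and is dominated by
    the modulus. *)
Lemma open_Re_gt F (L : R[i] -> R) a : continuous F ->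
  {morph L : x y / x - y} -> (forall z, L z <= complex.Re `|z|) ->
  open [set x | a < L (F x)].
Proof.
move=> cF LB Lle; rewrite openE => x /= aFx.
have e0 : 0 < (L (F x) - a)%:C by rewrite ltcR subr_gt0.
have /cvgrPdist_lt/(_ _ e0) Fx := cF x.
suff : nbhs x [set x | a < L (F x)] by [].
apply: filterS Fx => y Fxy; rewrite /=.
have : complex.Re `|F x - F y| < L (F x) - a.
  by rewrite -ltcR; move: Fxy; rewrite normc_def.
move=> /(le_lt_trans (Lle _)); rewrite LB.
lra.
Qed.

Lemma continuous_cmeasurable F : continuous F -> cmeasurable F.
Proof.
move=> cF; split; apply: lower_semicontinuous_measurable_Gbar => a.
  apply: (open_Re_gt a cF); last exact: Re_le_norm.
  by move=> x y; rewrite raddfB.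
apply: (open_Re_gt a cF); first by move=> x y; rewrite raddfB.
move=> z; have -> : complex.Im z = complex.Re (- (z * 'i%C)).
  by rewrite raddfN/= ReiNIm opprK.
apply: le_trans (Re_le_norm _) _; rewrite normrN normrM.
rewrite (_ : `|'i%C : R[i]| = 1) ?mulr1//.
by rewrite normc_def/= expr0n/= expr1n add0r sqrtr1.
Qed.

Lemma eq_cintegral F F' : F =1 F' -> cintegral mu F = cintegral mu F'.
Proof. by move=> /funext->. Qed.

Lemma cintegral_scaling (phi : Gb -> Gb) (c : R) F :
  measurable_fun setT (phi : borelGbar H -> borelGbar H) -> 0 < c ->
  (forall E : set (borelGbar H), measurable E ->
    mu (phi @^-1` E) = (c%:E * mu E)%E) ->
  cmeasurable F ->
  cintegral mu (F \o phi) = c%:C * cintegral mu F.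
Proof.
move=> mphi c0 muphi [mRe mIm]; rewrite /cintegral.
rewrite (Rintegral_scaling mphi c0 muphi mRe).
rewrite (Rintegral_scaling mphi c0 muphi mIm).
by simpc.
Qed.

Lemma cintegral_gt0Zl (c : R) F : 0 < c -> cmeasurable F ->
  cintegral mu (fun y => c%:C * F y) = c%:C * cintegral mu F.
Proof.
move=> c0 [mRe mIm]; rewrite /cintegral; simpc.
rewrite -(Rintegral_gt0Zl mu c0 mRe) -(Rintegral_gt0Zl mu c0 mIm).
by congr (_ +i* _); apply: eq_Rintegral => x _ /=; case: (F x) => a b; simpc.
Qed.

Definition cintegrable F :=
  mu.-integrable setT (EFin \o (@complex.Re R \o F)) /\
  mu.-integrable setT (EFin \o (@complex.Im R \o F)).

Lemma cintegralD F F' : cintegrable F -> cintegrable F' ->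
  cintegral mu (F + F') = cintegral mu F + cintegral mu F'.
Proof.
move=> [Fr Fi] [F'r F'i]; rewrite /cintegral; simpc.
rewrite -!RintegralD//; congr (_ +i* _); apply: eq_Rintegral => x _ /=;
  by rewrite !fctE raddfD.
Qed.

Lemma cintegrableD F F' :
  cintegrable F -> cintegrable F' -> cintegrable (F + F').
Proof.
move=> [Fr Fi] [F'r F'i]; split.
  apply: eq_integrable (integrableD _ Fr F'r) => // x _ /=.
  by rewrite !fctE raddfD.
apply: eq_integrable (integrableD _ Fi F'i) => // x _ /=.
by rewrite !fctE raddfD.
Qed.

Lemma cintegrableZ c F : cintegrable F -> cintegrable (c *: F).
Proof.
case: c => a b [Fr Fi]; split.
  apply: eq_integrable (integrableB _ (integrableZl _ a Fr) (integrableZl _ b Fi)) => // x _ /=.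
  by rewrite !fctE; case: (F x).
apply: eq_integrable (integrableD _ (integrableZl _ a Fi) (integrableZl _ b Fr)) => // x _ /=.
by rewrite !fctE; case: (F x).
Qed.

Lemma cintegralZ c F : cintegrable F ->
  cintegral mu (c *: F) = c * cintegral mu F.
Proof.
case: c => a b [Fr Fi]; rewrite /cintegral; simpc.
rewrite -!RintegralZl// -RintegralB//;
  [|exact: (integrableZl _ a Fr)|exact: (integrableZl _ b Fi)].
rewrite -RintegralD//; [|exact: (integrableZl _ a Fi)|exact: (integrableZl _ b Fr)].
by congr (_ +i* _); apply: eq_Rintegral => x _ /=; rewrite !fctE; case: (F x).
Qed.

Lemma cintegrable0 : cintegrable 0.
Proof.
by split; apply: eq_integrable (integrable0 mu setT).
Qed.

Lemma cintegral0 : cintegral mu 0 = 0.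
Proof.
by rewrite /cintegral/= (_ : (fun=> _) = cst 0)// !Rintegral_cst//= mul0r.
Qed.

Lemma cintegrable_indic (E : set (borelGbar H)) : measurable E ->
  (mu E < +oo)%E -> cintegrable (\1_E : Gb -> R[i]^o).
Proof.
move=> mE muE; split; last first.
  apply: eq_integrable (integrable0 mu setT) => // x _ /=.
  by rewrite indicE; case: (_ \in _).
apply: (@eq_integrable _ _ _ _ _ _ (EFin \o (\1_E : _ -> R))) => //.
  by move=> x _ /=; rewrite !indicE; case: (_ \in _).
apply/integrableP; split; first exact/measurable_EFinP/measurable_indic.
under eq_integral do rewrite /= ger0_norm ?indicE//.
by rewrite integral_indic// setIT.
Qed.

Lemma cintegral_indic (E : set (borelGbar H)) : measurable E ->
  cintegral mu (\1_E : Gb -> R[i]^o) = (fine (mu E))%:C.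
Proof.
move=> mE; rewrite /cintegral; congr (_ +i* _); last first.
  rewrite (_ : (fun=> _) = cst 0); first by rewrite Rintegral_cst//= mul0r.
  by apply/funext => x; rewrite indicE; case: (_ \in _).
rewrite /Rintegral -[in RHS](setIT E) -integral_indic//; congr fine.
by apply: eq_integral => x _; rewrite !indicE; case: (_ \in _).
Qed.

End Integral.

(** * Convolution and the Hecke algebra *)

Section HeckeAlgebra.
Variables (R : realType) (G : groupType) (H : groupClosed G).
Local Notation Gb := (Gbar H).
Local Notation Hb := (Hbar H).
Local Notation p := (projH R H).
Hypothesis hecke : hecke_pair H.
Variable mu : {measure set (borelGbar H) -> \bar R}.
Hypothesis haar : left_haar mu.
Implicit Types f g : Gb -> R[i]^o.

Lemma preimage_gmull a (E : set Gb) :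
  (fun y => a ** y) @^-1` E = [set ginv a ** y | y in E].
Proof.
apply/seteqP; split=> [y Ey|_ [y Ey <-]].
  by exists (a ** y) => //; rewrite (gmulKg hecke).
by rewrite /preimage/= (gmulVKg hecke).
Qed.

Lemma preimage_gmulr a (E : set Gb) :
  (fun y => y ** a) @^-1` E = [set y ** ginv a | y in E].
Proof.
apply/seteqP; split=> [y Ey|_ [y Ey <-]].
  by exists (y ** a) => //; rewrite (gmulgK hecke).
by rewrite /preimage/= (gmulgKV hecke).
Qed.

Lemma cintegral_gmull a f : cmeasurable f ->
  cintegral mu (fun y => f (a ** y)) = cintegral mu f.
Proof.
move=> mf; rewrite -[RHS]mul1r.
rewrite -(cintegral_scaling (phi := fun y => a ** y) (c := 1))//.
  by apply: continuous_measurable_Gbar; exact: gmull_continuous.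
by move=> E mE; rewrite preimage_gmull mul1e; case: haar => + _ _ _ _; exact.
Qed.

Lemma measurable_hcoset x : measurable (hcoset x : set (borelGbar H)).
Proof. by apply: open_measurable_Gbar; exact: open_hcoset. Qed.

Lemma mu_hcoset x : mu (hcoset x) = 1%E.
Proof.
rewrite (hcosetE hecke); case: haar => + _ _ _ <-; apply.
by apply: open_measurable_Gbar; exact: open_Hbar.
Qed.

Lemma cintegrable_hcoset x (E : set (borelGbar H)) : measurable E ->
  E `<=` hcoset x -> cintegrable mu (\1_E : Gb -> R[i]^o).
Proof.
move=> mE Ex; apply: cintegrable_indic => //.
apply: (@le_lt_trans _ _ (mu (hcoset x))); last by rewrite mu_hcoset ltry.
by apply: le_measure; rewrite ?inE//; exact: measurable_hcoset.
Qed.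

Lemma cintegrable_chi x : cintegrable mu (chi x).
Proof. by apply: (cintegrable_hcoset (x := x)) => //; exact: measurable_hcoset. Qed.

Lemma cintegral_chi x : cintegral mu (chi x) = 1.
Proof.
rewrite cintegral_indic ?mu_hcoset//; exact: measurable_hcoset.
Qed.

Lemma projHE y : p y = (y \in Hb)%:R.
Proof. by rewrite /projH indicE. Qed.

(** [f y * p (y^-1 x)] lives on the coset of [x], where [f] is constantly [f x], and every coset has
    measure 1. *)
Lemma convol_projr f : right_invariant f -> convol mu f p = f.
Proof.
move=> fr; apply/funext => x; rewrite /convol.
rewrite (eq_cintegral _ (F' := f x *: chi x)).
  by rewrite cintegralZ ?cintegral_chi ?mulr1//; exact: cintegrable_chi.
move=> y; rewrite !fctE projHE /chi indicE.
case: (pselect (hcoset x y)) => xy.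
  rewrite (mem_set xy) mem_set; last exact: hcoset_sym.
  by rewrite (right_invariant_hcoset hecke fr xy).
by rewrite !memNset ?scaler0 ?mulr0// => yx; apply: xy; exact: hcoset_sym.
Qed.

(** On the coset of [x] the factor [f (y^-1 z)] is constantly [f (x^-1 z)]. This is how products
    with indicators are evaluated below. *)
Lemma convol_chil x f : left_invariant f ->
  convol mu (chi x) f = fun z => f (ginv x ** z).
Proof.
move=> fl; apply/funext => z; rewrite /convol.
rewrite (eq_cintegral _ (F' := f (ginv x ** z) *: chi x)).
  by rewrite cintegralZ ?cintegral_chi ?mulr1//; exact: cintegrable_chi.
move=> y; rewrite !fctE /chi indicE.
case: (pselect (hcoset x y)) => xy; last by rewrite memNset// scaler0 mul0r.
rewrite mem_set// mul1r [RHS]mulr1.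
have -> : ginv y ** z = ginv (ginv x ** y) ** (ginv x ** z).
  by rewrite (ginvM hecke) (ginvK hecke) -gmulA (gmulVKg hecke).
by rewrite fl//; exact: ginv_Hbar.
Qed.

Lemma convol_projl f : left_invariant f -> convol mu p f = f.
Proof.
move=> fl; rewrite -(chi1 hecke) convol_chil//; apply/funext => z.
by rewrite (ginv1 hecke) gmul1g.
Qed.

Lemma convol_right_invariant f g :
  right_invariant g -> right_invariant (convol mu f g).
Proof.
move=> gr x h hH; apply: eq_cintegral => y.
by rewrite gmulA gr.
Qed.

Lemma projH_invariant : left_invariant p /\ right_invariant p.
Proof.
split=> [h x|x h] hH; rewrite !projHE; congr (nat_of_bool _)%:R;
  apply/idP/idP => /set_mem xH; apply/mem_set.
- by rewrite -(gmulKg hecke h x); apply: gmul_Hbar => //; exact: ginv_Hbar.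
- exact: gmul_Hbar.
- by rewrite -(gmulgK hecke h x); apply: gmul_Hbar => //; exact: ginv_Hbar.
- exact: gmul_Hbar.
Qed.

Lemma ginv_gmulr_continuous z : continuous (fun y : Gb => ginv y ** z).
Proof.
move=> y; apply: (@continuous_comp _ _ _ (@ginv G H) (fun y => y ** z)).
  exact: ginv_continuous.
exact: gmulr_continuous.
Qed.

(** Substitute [h ** y] for [y] under the left invariant integral; continuity of both factors makes
    the integrand measurable. *)
Lemma left_invariant_convol f g : continuous f -> continuous g ->
  left_invariant f -> left_invariant (convol mu f g).
Proof.
move=> fc gc fl h x hH; rewrite /convol.
pose F y := f y * g (ginv y ** (h ** x)).
rewrite -[LHS]/(cintegral mu F) -(cintegral_gmull h); last first.
  apply: continuous_cmeasurable => y.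
  apply: (@continuousM _ _ f (fun y => g (ginv y ** (h ** x)))); first exact: fc.
  apply: (@continuous_comp _ _ _ (fun y => ginv y ** (h ** x)) g).
    exact: ginv_gmulr_continuous.
  exact: gc.
apply: eq_cintegral => y; rewrite /F fl//.
by rewrite (ginvM hecke) -gmulA (gmulKg hecke).
Qed.

(** If [y] lies in [a Hb] and [y^-1 x] in a coset from [t], then [a^-1 x] lies in [Hb] times that
    coset, hence in a coset from [u]. *)
Lemma coset_finite_convol f g :
  coset_finite f -> coset_finite g -> coset_finite (convol mu f g).
Proof.
move=> [s fs] [t gt]; have [u tu] := Hbar_mul_hcosets hecke t.
exists [seq y ** z | y <- s, z <- u] => x; apply: contraNP => xsu; apply/eqP.
rewrite /convol (eq_cintegral _ (F' := 0)) ?cintegral0// => y.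
have [->|/fs[a sa ay]] := eqVneq (f y) 0; first by rewrite mul0r.
have [->|/gt/(tu _ _ ay)] := eqVneq (g (ginv y ** x)) 0; first by rewrite mulr0.
rewrite -gmulA (gmulVKg hecke) => -[b ub bx]; exfalso; apply: xsu.
by exists (a ** b); [exact: allpairs_f|rewrite -(gmulVKg hecke a x) hcosetMl].
Qed.

Lemma coset_finite_projH : coset_finite p.
Proof. by rewrite -(chi1 hecke); exact: chi_coset_finite. Qed.

Lemma projH_Cc : Cc p.
Proof.
rewrite -(chi1 hecke); apply: (coset_finite_Cc hecke).
  by apply: (right_invariant_continuous hecke); exact: chi_right_invariant.
exact: chi_coset_finite.
Qed.

Lemma CcpP f : Ccp mu f <-> right_invariant f /\ coset_finite f.
Proof.
split=> [[f0 f0c <-]|[fr fs]].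
  split; first by apply: convol_right_invariant; exact: projH_invariant.2.
  by apply: coset_finite_convol; [exact: (Cc_coset_finite hecke)|exact: coset_finite_projH].
exists f; last exact: convol_projr.
by apply: coset_finite_Cc => //; exact: right_invariant_continuous.
Qed.

Lemma convol_projl_Cc f : Cc f -> Cc (convol mu p f).
Proof.
move=> fc; have pf : left_invariant (convol mu p f).
  by apply: left_invariant_convol => //;
    [exact: projH_Cc.1|exact: fc.1|exact: projH_invariant.1].
apply: coset_finite_Cc => //; first exact: left_invariant_continuous.
by apply: coset_finite_convol; [exact: coset_finite_projH|exact: Cc_coset_finite].
Qed.

Lemma hecke_algebraP f : hecke_algebra mu f <->
  [/\ left_invariant f, right_invariant f & coset_finite f].
Proof.
split=> [[f0 f0c <-]|[fl fr fs]].
  have pf : Cc (convol mu p f0) := convol_projl_Cc f0c.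
  split.
  - apply: left_invariant_convol; [exact: pf.1|exact: projH_Cc.1|].
    by apply: left_invariant_convol; [exact: projH_Cc.1|exact: f0c.1|exact: projH_invariant.1].
  - by apply: convol_right_invariant; exact: projH_invariant.2.
  - by apply: coset_finite_convol; [exact: Cc_coset_finite|exact: coset_finite_projH].
exists f; last by rewrite convol_projl// convol_projr.
by apply: coset_finite_Cc => //; exact: right_invariant_continuous.
Qed.

Lemma hecke_algebra_Cc f : hecke_algebra mu f -> Cc f.
Proof.
move=> /hecke_algebraP[_ fr fs]; apply: coset_finite_Cc => //.
exact: right_invariant_continuous.
Qed.

Lemma coset_finite_lin c f g :
  coset_finite f -> coset_finite g -> coset_finite (c *: f + g).
Proof.
move=> [s fs] [t gt]; exists (s ++ t) => x; rewrite hcosets_cat.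
apply: contra_neqP => /not_orP[xs xt]; rewrite !fctE.
have -> : f x = 0 by apply: contra_notP xs => /eqP; exact: fs.
have -> : g x = 0 by apply: contra_notP xt => /eqP; exact: gt.
by rewrite scaler0 addr0.
Qed.

Lemma hecke_algebra_lin c f g :
  hecke_algebra mu f -> hecke_algebra mu g -> hecke_algebra mu (c *: f + g).
Proof.
move=> /hecke_algebraP[fl fr fs] /hecke_algebraP[gl gr gs].
apply/hecke_algebraP; split; last exact: coset_finite_lin.
  by move=> h x hH; rewrite !fctE fl// gl.
by move=> x h hH; rewrite !fctE fr// gr.
Qed.

Lemma hecke_algebra_convol_projl f : right_invariant f -> coset_finite f ->
  hecke_algebra mu (convol mu p f).
Proof.
move=> fr fs; apply/hecke_algebraP; split.
- apply: left_invariant_convol; [exact: projH_Cc.1| |exact: projH_invariant.1].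
  exact: right_invariant_continuous.
- exact: convol_right_invariant.
- by apply: coset_finite_convol => //; exact: coset_finite_projH.
Qed.

Lemma hecke_algebra_convol f g :
  hecke_algebra mu f -> hecke_algebra mu g -> hecke_algebra mu (convol mu f g).
Proof.
move=> hf hg; have [fl fr fs] := (hecke_algebraP f).1 hf.
have [gl gr gs] := (hecke_algebraP g).1 hg.
apply/hecke_algebraP; split; last exact: coset_finite_convol.
  by apply: left_invariant_convol => //;
    [exact: (hecke_algebra_Cc hf).1|exact: (hecke_algebra_Cc hg).1].
exact: convol_right_invariant.
Qed.

Lemma projH_hecke : hecke_algebra mu p.
Proof.
apply/hecke_algebraP; split; [exact: projH_invariant.1|exact: projH_invariant.2|].
exact: coset_finite_projH.
Qed.

(** The integral is a total function, additive only on integrable functions. So integrability of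
    [p y * f (y^-1 z)] has to be shown: for [chi u] this is the indicator of an open subset of [Hb],
    and combinations follow by induction. *)
Lemma convol_projl_lin c x f : right_invariant f -> coset_finite f ->
  convol mu p (c *: chi x + f) = c *: convol mu p (chi x) + convol mu p f.
Proof.
have int_chi u z : cintegrable mu (fun y => p y * chi u (ginv y ** z)).
  pose E := Hb `&` (fun y => ginv y ** z) @^-1` hcoset u.
  rewrite (_ : (fun _ => _) = \1_E).
    apply: (cintegrable_hcoset (x := gone H)); last by rewrite (hcoset1 hecke) => y [].
    apply: open_measurable_Gbar; apply: openI; first exact: open_Hbar.
    apply: open_comp; last exact: open_hcoset.
    by move=> y _; exact: ginv_gmulr_continuous.
  apply/funext => y; rewrite /projH /chi !indicE -natrM mulnb.
  by rewrite /E in_setI.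
move=> fr fs; have int_f z : cintegrable mu (fun y => p y * f (ginv y ** z)).
  move: f fr fs; apply: (right_invariant_ind hecke).
    rewrite (_ : (fun _ => _) = 0); first exact: cintegrable0.
    by apply/funext => y; rewrite mulr0.
  move=> a u f fr fs IH; have := cintegrableD (cintegrableZ a (int_chi u z)) IH.
  congr cintegrable; apply/funext => y; rewrite !fctE mulrDr; congr (_ + _).
  by rewrite scalerAr.
apply/funext => z.
transitivity (cintegral mu (c *: (fun y => p y * chi x (ginv y ** z)) +
    (fun y => p y * f (ginv y ** z)))).
  by apply: eq_cintegral => y; rewrite !fctE mulrDr scalerAr.
rewrite cintegralD; [|by apply: cintegrableZ; exact: int_chi|exact: int_f].
by rewrite cintegralZ //; exact: int_chi.
Qed.

End HeckeAlgebra.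

(** * Directed pairs *)

Section Directed.
Variables (G : groupType) (H : groupClosed G).
Local Notation Gb := (Gbar H).
Local Notation Hb := (Hbar H).
Hypothesis hecke : hecke_pair H.

(* The analogue of [dirT] for the completed pair, [t Hb t^-1 >= Hb] being
   written as [t^-1 Hb t <= Hb]. *)
Definition dirTbar : set Gb :=
  [set t | forall h, Hb h -> Hb (ginv t ** h ** t)].

Lemma dirTbar_Hbar h : Hb h -> dirTbar h.
Proof.
by move=> hH k kH; apply: gmul_Hbar => //; apply: gmul_Hbar => //; exact: ginv_Hbar.
Qed.

Lemma dirTbarM s t : dirTbar s -> dirTbar t -> dirTbar (s ** t).
Proof.
move=> sT tT h hH; rewrite (ginvM hecke) (_ : _ ** _ = ginv t ** (ginv s ** h ** s) ** t).
  exact/tT/sT.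
by rewrite !gmulA.
Qed.

Lemma Hbar_approx (k : Gb) (C : cosets H) : Hb k ->
  exists2 h, h \in H & Gbar_fun k C = theta (H := H) h C.
Proof.
have /open_nbhs_nbhs : open_nbhs (Gbar_fun k)
    [set f : cosetMap H | f C = Gbar_fun k C].
  by split=> //; exact: open_eval_map.
by move=> /[swap] /[apply] -[_ [[h hH <-] /= <-]]; exists h.
Qed.

(** At the coset [tH] the element [k] acts as some [h] in [H], which is [t l t^-1] with [l] in [H];
    so [t^-1 k t] fixes the base coset. *)
Lemma dirT_dirTbar t : dirT H t -> dirTbar (Gbar_theta H t).
Proof.
move=> tT k kH; rewrite HbarE /= !Gbar_funM Gbar_fun_theta theta_coset mulg1.
have [h hH ->] := Hbar_approx (coset_of_elt H t) kH.
have [l lH lh] := tT h hH.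
rewrite (ginv_uniq hecke (y := Gbar_theta H t^-1)); last first.
  by rewrite -Gbar_thetaM mulgV.
rewrite Gbar_fun_theta !theta_coset -lh; apply/coset_of_elt_eq.
by rewrite mulg1 !mulgA mulVg mul1g mulgVK gpredV.
Qed.

Hypothesis directed : directed_pair H.

(** Write [x = g k] and [g = s^-1 t]; then [s x = t k] is a product of two elements of [dirTbar]. *)
Lemma Gbar_directed x : exists2 s, dirTbar s & dirTbar (s ** x).
Proof.
have [g [k [kH ->]]] := Gbar_decomp x; have [s [t [sT tT ->]]] := directed g.
exists (Gbar_theta H s); first exact: dirT_dirTbar.
rewrite gmulA -Gbar_thetaM mulVKg; apply: dirTbarM; first exact: dirT_dirTbar.
exact: dirTbar_Hbar.
Qed.

Lemma Gbar_directed_seq (s : seq Gb) :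
  exists2 a, dirTbar a & forall x, x \in s -> dirTbar (a ** x).
Proof.
elim: s => [|x s [a aT aTs]].
  by exists (gone H) => //; apply: dirTbar_Hbar; exact: gone_Hbar.
(* Directedness is applied to [a ** x] rather than [x], so that [b] multiplies [a] from the left and
   keeps the earlier points inside. *)
have [b bT baT] := Gbar_directed (a ** x).
exists (b ** a); first exact: dirTbarM.
move=> y; rewrite inE => /orP[/eqP->|ys]; rewrite -gmulA//.
by apply: dirTbarM => //; exact: aTs.
Qed.

Lemma chi_left_invariant (R : realType) t :
  dirTbar t -> left_invariant (chi t : Gb -> R[i]^o).
Proof.
move=> tT.
have hc h y : Hb h -> hcoset t y -> hcoset t (h ** y).
  move=> hH ty; rewrite /hcoset/= (_ : _ ** _ = (ginv t ** h ** t) ** (ginv t ** y)).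
    by apply: gmul_Hbar => //; exact: tT.
  by rewrite -!gmulA (gmulVKg hecke).
move=> h y hH; rewrite /chi !indicE; congr (nat_of_bool _)%:R.
apply/idP/idP => /set_mem ty; apply/mem_set; last exact: hc.
by rewrite -(gmulKg hecke h y); apply: hc => //; exact: ginv_Hbar.
Qed.

End Directed.

(** * The modular function, the involution and positivity *)

Section Modular.
Variables (R : realType) (G : groupType) (H : groupClosed G).
Local Notation Gb := (Gbar H).
Local Notation Hb := (Hbar H).
Local Notation p := (projH R H).
Hypothesis hecke : hecke_pair H.
Variable mu : {measure set (borelGbar H) -> \bar R}.
Hypothesis haar : left_haar mu.
Variable Delta : Gb -> R.
Hypothesis modular : modular_function mu Delta.
Implicit Types f g : Gb -> R[i]^o.

Lemma Delta_gt0 x : 0 < Delta x. Proof. by case: (modular x). Qed.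

Lemma mu_gmulr x (E : set (borelGbar H)) : measurable E ->
  mu [set y ** x | y in E] = ((Delta x)%:E * mu E)%E.
Proof. by case: (modular x) => _; exact. Qed.

Lemma mu_Hbar : mu Hb = 1%E. Proof. by case: haar. Qed.

(** Both sides measure [Hb x y], as a translate of [Hb] and as a translate of [Hb x]; [Hb] has
    measure 1, so the factors can be read off. *)
Lemma DeltaM x y : Delta (x ** y) = Delta x * Delta y.
Proof.
have mH : measurable (Hb : set (borelGbar H)).
  by apply: open_measurable_Gbar; exact: open_Hbar.
have mHx : measurable ([set h ** x | h in Hb] : set (borelGbar H)).
  rewrite -(ginvK hecke x) -(preimage_gmulr hecke).
  apply: open_measurable_Gbar; apply: open_comp; last exact: open_Hbar.
  by move=> z _; exact: gmulr_continuous.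
have := mu_gmulr (x ** y) mH; rewrite mu_Hbar mule1.
rewrite (_ : [set _ | _ in _] = [set z ** y | z in [set h ** x | h in Hb]]).
  by rewrite mu_gmulr// mu_gmulr// mu_Hbar mule1 -EFinM mulrC => -[].
rewrite image_comp; apply: eq_imagel => h _; by rewrite /= gmulA.
Qed.

Lemma Delta_Hbar h : Hb h -> Delta h = 1.
Proof.
move=> hH; have := mu_gmulr h (open_measurable_Gbar (@open_Hbar _ H)).
rewrite mu_Hbar mule1 (_ : [set _ | _ in _] = Hb) ?mu_Hbar; first by case.
apply/seteqP; split=> [_ [k kH <-]|k kH]; first exact: gmul_Hbar.
exists (k ** ginv h); last exact: (gmulgKV hecke).
by apply: gmul_Hbar => //; exact: ginv_Hbar.
Qed.

Lemma Delta1 : Delta (gone H) = 1.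
Proof. by apply: Delta_Hbar; exact: gone_Hbar. Qed.

Lemma invol_left_invariant f :
  right_invariant f -> left_invariant (invol Delta f).
Proof.
move=> fr h x hH; have hV := ginv_Hbar hecke hH.
by rewrite /invol (ginvM hecke) fr// DeltaM (Delta_Hbar hV) mulr1.
Qed.

Lemma invol_right_invariant f :
  left_invariant f -> right_invariant (invol Delta f).
Proof.
move=> fl x h hH; have hV := ginv_Hbar hecke hH.
by rewrite /invol (ginvM hecke) fl// DeltaM (Delta_Hbar hV) mul1r.
Qed.

Lemma invol_hecke f : hecke_algebra mu f -> hecke_algebra mu (invol Delta f).
Proof.
move=> /(hecke_algebraP hecke haar)[fl fr [s fs]].
apply/(hecke_algebraP hecke haar); split.
- exact: invol_left_invariant.
- exact: invol_right_invariant.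
(* [x^-1] in [y Hb] means [x] in [Hb y^-1], which finitely many left cosets cover. *)
have [t st] := Hbar_mul_hcosets hecke [seq ginv y | y <- s].
exists t => x; rewrite /invol mulf_eq0 negb_or conjC_eq0 => /andP[/fs[y ys yx] _].
have -> : x = ginv (ginv y ** ginv x) ** ginv y.
  by rewrite (ginvM hecke) (ginvK hecke) (ginvK hecke) (gmulgK hecke).
apply: st; first exact: ginv_Hbar.
by exists (ginv y); [exact: map_f|exact: hcoset_refl].
Qed.

Lemma invol_projH : invol Delta p = p.
Proof.
have pV x : p (ginv x) = p x.
  rewrite !projHE; congr (nat_of_bool _)%:R; apply/idP/idP => /set_mem/(ginv_Hbar hecke).
    by rewrite (ginvK hecke) => ?; exact/mem_set.
  by move=> ?; exact/mem_set.
have conj_bool (b : bool) : Num.conj (b%:R : R[i]^o) = b%:R.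
  by case: b; [exact: conjC1|exact: conjC0].
apply/funext => x; rewrite /invol pV projHE. rewrite conj_bool.
case: (pselect (Hb x)) => xH; last by rewrite memNset//= mul0r.
by rewrite mem_set//= mul1r Delta_Hbar//; exact: ginv_Hbar.
Qed.

Definition ltrans (a : Gb) f : Gb -> R[i]^o := fun y => f (ginv a ** y).

Lemma ltrans_right_invariant a f :
  right_invariant f -> right_invariant (ltrans a f).
Proof. by move=> fr x h hH; rewrite /ltrans gmulA fr. Qed.

Lemma ltrans_chi a x : ltrans a (chi x) = chi (a ** x).
Proof.
apply/funext => y; rewrite /ltrans /chi !indicE; congr (nat_of_bool _)%:R.
apply/idP/idP => /set_mem xy; apply/mem_set; move: xy.
  by rewrite -(hcosetMl hecke a) (gmulVKg hecke).
by rewrite -{1}(gmulVKg hecke a y) hcosetMl.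
Qed.

Lemma ltrans_projH a : ltrans a p = chi a.
Proof. by rewrite -(chi1 hecke) ltrans_chi gmulg1. Qed.

(* The factor [Delta] in [invol] absorbs the scaling of [mu] under the right
   translation that undoes the left translations by [a]. *)
Lemma convol_invol_ltrans a f g : right_invariant f -> continuous g ->
  convol mu (invol Delta (ltrans a f)) (ltrans a g) =
  convol mu (invol Delta f) g.
Proof.
move=> fr gc; apply/funext => z; rewrite /convol.
pose F y := invol Delta f y * g (ginv y ** z).
have cF0 : continuous F.
  move=> y.
  apply: (@continuousM _ _ (invol Delta f) (fun y => g (ginv y ** z))).
    by apply: (left_invariant_continuous hecke); exact: invol_left_invariant.
  apply: (@continuous_comp _ _ _ (fun y => ginv y ** z) g); last exact: gc.
  exact: ginv_gmulr_continuous.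
have mF := continuous_cmeasurable cF0.
have cF : cintegral mu (F \o (fun y => y ** a)) =
    (Delta (ginv a))%:C * cintegral mu F.
  apply: cintegral_scaling => //; last 2 first.
  - exact: Delta_gt0.
  - by move=> E mE; rewrite preimage_gmulr// mu_gmulr.
  by apply: continuous_measurable_Gbar; exact: gmulr_continuous.
have aV : (Delta a)%:C * (Delta (ginv a))%:C = 1 :> R[i].
  by rewrite -rmorphM/= -DeltaM (gmulgV hecke) Delta1.
(* [Delta a], inserted with its inverse, moves under the integral and cancels the factor
   [Delta (a^-1)] of the shifted [invol]. *)
rewrite -[RHS]mul1r -[X in _ = X * _]aV -mulrA -cF -cintegral_gt0Zl.
- apply: eq_cintegral => y; rewrite /F /invol /ltrans /= !(ginvM hecke) DeltaM.
  rewrite -(gmulA (ginv a) (ginv y) z) (rmorphM (real_complex R)) /=.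
  move: (g _) (Num.conj _) (Delta (ginv y))%:C aV => u v w.
  move: (Delta a)%:C (Delta (ginv a))%:C => b c bc.
  have lin (x1 x2 x3 x4 x5 : R[i]) : x4 * x5 = 1 ->
      x2 * x3 * x1 = x4 * (x2 * (x5 * x3) * x1).
    by move=> x45; rewrite -[LHS]mul1r -x45; ring.
  exact: lin.
- exact: Delta_gt0.
- apply: continuous_cmeasurable => y.
  apply: (@continuous_comp _ _ _ (fun y => y ** a) F); first exact: gmulr_continuous.
  exact: cF0.
Qed.

Lemma chi_hecke t : dirTbar t -> hecke_algebra mu (chi t).
Proof.
move=> tT; apply/(hecke_algebraP hecke haar); split.
- exact: chi_left_invariant.
- exact: chi_right_invariant.
- exact: chi_coset_finite.
Qed.

Lemma chi_continuous x : continuous (chi x : Gb -> R[i]^o).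
Proof. by apply: right_invariant_continuous => //; exact: chi_right_invariant. Qed.

Lemma convol_chi s t : dirTbar t -> convol mu (chi s) (chi t) = chi (s ** t) :> (Gb -> R[i]^o).
Proof.
move=> tT; rewrite convol_chil//; last exact: chi_left_invariant.
exact: ltrans_chi.
Qed.

(** [chi s] and [chi (s ** x)] are the translates by [s] of [p] and [chi x], and the translations
    cancel. With [x = 1] this makes [V_s] a partial isometry; with [s] and [s ** x] in [dirTbar] it
    factors [p * chi x] inside the Hecke algebra. *)
Lemma convol_invol_chi s x :
  convol mu (invol Delta (chi s)) (chi (s ** x)) = convol mu p (chi x) :> (Gb -> R[i]^o).
Proof.
rewrite -ltrans_projH -ltrans_chi convol_invol_ltrans ?invol_projH//.
  exact: (projH_invariant R hecke).2.
exact: chi_continuous.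
Qed.

Lemma inner_product_positive f : directed_pair H -> Ccp mu f ->
  exists2 g, hecke_algebra mu g &
    convol mu (invol Delta f) f = convol mu (invol Delta g) g.
Proof.
move=> directed /(CcpP hecke haar)[fr [s fs]].
have [a aT aTs] := Gbar_directed_seq hecke directed s.
exists (ltrans a f); last first.
  by rewrite convol_invol_ltrans//; exact: right_invariant_continuous.
apply/(hecke_algebraP hecke haar); split; last 2 first.
- exact: ltrans_right_invariant.
- exists [seq a ** x | x <- s] => y /fs[x xs xy].
  by exists (a ** x); [exact: map_f|rewrite -(gmulVKg hecke a y) hcosetMl].
(* A point [y] where the translate is nonzero lies in some [a x Hb] with [a x] in [dirTbar], and
   left multiplication by [Hb] preserves that coset. *)
have fh h y : Hb h -> ltrans a f y != 0 -> ltrans a f (h ** y) = ltrans a f y.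
  move=> hH /fs[x xs xy]; rewrite /ltrans (right_invariant_hcoset hecke fr xy).
  apply: (right_invariant_hcoset hecke fr).
  rewrite /hcoset/= (_ : _ ** _ = (ginv (a ** x) ** h ** (a ** x)) ** (ginv x ** (ginv a ** y))).
    by apply: gmul_Hbar => //; exact: aTs.
  by rewrite (ginvM hecke) -!gmulA !(gmulVKg hecke).
(* If the translate vanishes at [y] but not at [h y], the fact above is applied at [h y] with
   [h^-1]. *)
move=> h y hH; have [fy0|/fh->//] := eqVneq (ltrans a f y) 0.
have [fhy0|/(fh (ginv h))] := eqVneq (ltrans a f (h ** y)) 0; first by rewrite fy0 fhy0.
by rewrite (gmulKg hecke) => ->//; exact: ginv_Hbar.
Qed.

End Modular.

(** * Inverse limits of Hilbert spaces along contractions *)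

(** Cancels one factor in estimates [|T v|^2 <= |T v| * |v|], also when [T v = 0]. *)
Lemma le_of_sqr_le_mul (C : numDomainType) (a b : C) :
  0 <= a -> 0 <= b -> a ^+ 2 <= a * b -> a <= b.
Proof.
move=> a0 b0; have [->//|an0] := eqVneq a 0.
by rewrite expr2 ler_pM2l// lt_def an0.
Qed.

(** * Cauchy-Schwarz and polarization *)

Section HilbertBasics.
Variables (R : realType) (K : hilbertSpace R).
Local Notation C := R[i].
Implicit Types (u v w : K) (a : C).

Lemma hdotDl u v w : hdot K (u + v) w = hdot K u w + hdot K v w.
Proof. by rewrite linearDl. Qed.

Lemma hdotZl a u w : hdot K (a *: u) w = a * hdot K u w.
Proof. by rewrite linearZl_LR. Qed.

Lemma hdotC u v : hdot K u v = Num.conj (hdot K v u).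
Proof. by rewrite hermC expr0 mul1r. Qed.

Lemma hdotDr u v w : hdot K w (u + v) = hdot K w u + hdot K w v.
Proof. by rewrite hdotC hdotDl rmorphD/= -!hdotC. Qed.

Lemma hdotZr a u w : hdot K w (a *: u) = Num.conj a * hdot K w u.
Proof. by rewrite hdotC hdotZl rmorphM/= -!hdotC. Qed.

Lemma hdotNr u w : hdot K w (- u) = - hdot K w u.
Proof. by rewrite -scaleN1r hdotZr rmorphN rmorph1 mulN1r. Qed.

Lemma hdotBr u v w : hdot K w (u - v) = hdot K w u - hdot K w v.
Proof. by rewrite hdotDr hdotNr. Qed.

Lemma hdotBl u v w : hdot K (u - v) w = hdot K u w - hdot K v w.
Proof. by rewrite linearBl. Qed.

Lemma hdot0l w : hdot K 0 w = 0.
Proof. by rewrite linear0l. Qed.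

Lemma hdot_ext u v : (forall w, hdot K u w = hdot K v w) -> u = v.
Proof.
move=> uv; apply/eqP; rewrite -subr_eq0 -normr_eq0 -sqrf_eq0.
by rewrite -hdot_norm hdotBl uv subrr.
Qed.

Lemma cauchy_schwarz u v : `|hdot K u v| <= `|u| * `|v|.
Proof.
have [->|v0] := eqVneq v 0.
  by rewrite hdotC hdot0l rmorph0 !normr0 mulr0.
have nv : 0 < `|v| by rewrite normr_gt0.
rewrite -(ler_pM2r nv) -mulrA -expr2 -(@ler_pXn2r _ 2)// ?nnegrE ?mulr_ge0//.
pose a := `|v| ^+ 2; pose b := hdot K u v.
have areal : Num.conj a = a by rewrite conj_Creal// rpredX// normr_real.
(* The square of this norm is [a^2 |u|^2 - a |b|^2], the difference of the two sides of the goal. *)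
have := exprn_ge0 2 (normr_ge0 (a *: u - b *: v)); rewrite -hdot_norm.
rewrite hdotBl !hdotBr !hdotZl !hdotZr !hdot_norm (hdotC v u) -/b -/a areal => h.
rewrite -subr_ge0; apply: le_trans h _; rewrite le_eqVlt; apply/orP; left.
rewrite !exprMn (normCK b) -/a; apply/eqP; move: (Num.conj b) (`|u|) => x y.
by clear areal; move: a b x y => a b x y; ring.
Qed.

(** The imaginary unit enters as an abstract [j], a variable for [ring]; the two sides then differ
    by a multiple of [1 + j^2]. *)
Lemma polarization (j : C) u v : Num.conj j = - j -> j ^+ 2 = -1 ->
  4 * hdot K u v = `|u + v| ^+ 2 - `|u - v| ^+ 2 +
    j * (`|u + j *: v| ^+ 2) - j * (`|u - j *: v| ^+ 2).
Proof.
move=> jC j2.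
rewrite -!hdot_norm !hdotBl !hdotBr !hdotDl !hdotDr !hdotZl !hdotZr jC.
move: (hdot K u v) (hdot K v u) (hdot K u u) (hdot K v v) => x y z t.
apply/eqP; rewrite -subr_eq0.
rewrite [X in X == _](_ : _ = (1 + j ^+ 2) * (2 * x - 2 * y)); last by ring.
by rewrite j2 subrr mul0r.
Qed.

End HilbertBasics.

(* The preorder on the indices is left implicit: [y] is above [x] when
   [sys_map x y] is inhabited. *)
Record contractionSystem (R : realType) := ContractionSystem {
  sys_space : hilbertSpace R ;
  sys_index : Type ;
  sys_point : sys_index ;
  sys_map : sys_index -> sys_index -> set {linear sys_space -> sys_space} ;
  sys_contraction : forall x y W, sys_map x y W -> forall v, `|W v| <= `|v| ;
  sys_trans : forall x y z W W', sys_map x y W -> sys_map y z W' ->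
    exists W'', sys_map x z W'' ;
  sys_directed : forall x y, exists z W W', sys_map x z W /\ sys_map y z W' }.

Section Threads.
Variables (R : realType) (D : contractionSystem R).
Local Notation C := R[i].
Local Notation K := (sys_space D).
Local Notation X := (sys_index D).
Implicit Types F : X -> K.

(** Since the maps are contractions, the norms of a compatible family grow along the system; the
    bound makes their supremum finite. *)
Definition thread F :=
  (forall x y W, sys_map x y W -> W (F y) = F x) /\
  exists M : C, forall x, `|F x| <= M.

Definition threads : {pred X -> K} := fun F => `[< thread F >].

Lemma threads_submod_closed : submod_closed threads.
Proof.
split; first by apply/asboolP; split=> [x y W _|]; [exact: linear0|exists 0 => x; rewrite normr0].
move=> a F F' /asboolP[Fc [M FM]] /asboolP[Fc' [M' FM']]; apply/asboolP; split.
  by move=> x y W xy; rewrite linearP (Fc _ _ _ xy) (Fc' _ _ _ xy).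
exists (`|a| * M + M') => x; apply: le_trans (ler_normD _ _) _.
by rewrite normrZ; apply: lerD => //; exact: ler_wpM2l.
Qed.

HB.instance Definition _ :=
  GRing.isSubmodClosed.Build C (X -> K) threads threads_submod_closed.

Record limitSpace := LimitSpace {
  limit_fun :> X -> K ;
  limit_funP : limit_fun \in threads }.

HB.instance Definition _ := [isSub for limit_fun].
HB.instance Definition _ := [Choice of limitSpace by <:].
HB.instance Definition _ := [SubChoice_isSubLmodule of limitSpace by <:].

Local Notation L := limitSpace.
Implicit Types f g : L.

Lemma limit_funD f g x : (f + g) x = f x + g x. Proof. by []. Qed.
Lemma limit_funN f x : (- f) x = - f x. Proof. by []. Qed.
Lemma limit_funZ a f x : (a *: f) x = a *: f x. Proof. by []. Qed.
Lemma limit_fun0 x : (0 : L) x = 0. Proof. by []. Qed.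

Lemma limit_ext f g : (forall x, f x = g x) -> f = g.
Proof. by move=> fg; apply: val_inj; apply/funext. Qed.

Lemma limit_thread f : thread f.
Proof. by apply/asboolP; exact: limit_funP. Qed.

Definition limit_norms f : set R := range (fun x => complex.Re `|f x|).

(** Norms over [R[i]] take values in [R[i]], so the supremum is formed in [R] from real parts and
    then embedded. *)
Definition limit_norm f : C := (sup (limit_norms f))%:C.

Lemma norm_ReE (v : K) : `|v| = (complex.Re `|v|)%:C.
Proof. by rewrite RRe_real// normr_real. Qed.

Lemma limit_norms_sup f : has_sup (limit_norms f).
Proof.
split; first by exists (complex.Re `|f (sys_point D)|); exists (sys_point D).
have [_ [M fM]] := limit_thread f; exists (complex.Re M) => _ [x _ <-].
by have := fM x; rewrite lecE => /andP[].
Qed.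

Lemma limit_norm_ge f x : `|f x| <= limit_norm f.
Proof.
rewrite norm_ReE lecR; apply: sup_upper_bound; first exact: limit_norms_sup.
by exists x.
Qed.

Lemma limit_norm_le f M : (forall x, `|f x| <= M) -> limit_norm f <= M.
Proof.
move=> fM; have M0 : 0 <= M := le_trans (normr_ge0 _) (fM (sys_point D)).
rewrite -(RRe_real (ger0_real M0)) lecR.
apply: sup_le_ub; first exact: (limit_norms_sup f).1.
by move=> _ [x _ <-]; have := fM x; rewrite lecE => /andP[].
Qed.

Lemma limit_norm_ge0 f : 0 <= limit_norm f.
Proof. exact: le_trans (normr_ge0 _) (limit_norm_ge f (sys_point D)). Qed.

Lemma limit_normD f g : limit_norm (f + g) <= limit_norm f + limit_norm g.
Proof.
apply: limit_norm_le => x; apply: le_trans (ler_normD _ _) _.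
by apply: lerD; exact: limit_norm_ge.
Qed.

Lemma limit_normZ_le a f : limit_norm (a *: f) <= `|a| * limit_norm f.
Proof.
apply: limit_norm_le => x; rewrite limit_funZ normrZ.
by apply: ler_wpM2l => //; exact: limit_norm_ge.
Qed.

Lemma limit_norm_eq0 f : limit_norm f = 0 -> f = 0.
Proof.
move=> f0; apply: limit_ext => x; apply/eqP; rewrite limit_fun0 -normr_le0 -f0.
exact: limit_norm_ge.
Qed.

Lemma limit_normZ a f : limit_norm (a *: f) = `|a| * limit_norm f.
Proof.
apply/eqP; rewrite eq_le limit_normZ_le /=; have [->|a0] := eqVneq a 0.
  by rewrite normr0 mul0r limit_norm_ge0.
have := limit_normZ_le a^-1 (a *: f); rewrite scalerA mulVf// scale1r normfV.
by rewrite ler_pdivlMl ?normr_gt0.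
Qed.

HB.instance Definition _ := @Lmodule_isNormed.Build C L limit_norm
  limit_normD limit_normZ limit_norm_eq0.

Lemma limit_normE f : `|f| = limit_norm f. Proof. by []. Qed.

Lemma limit_dist_ge f g x : `|f x - g x| <= `|f - g|.
Proof. exact: (limit_norm_ge (f - g) x). Qed.

Lemma limit_ballE f g e : ball f e g = (`|f - g| < e).
Proof. by rewrite -ball_normE. Qed.

(** Pointwise limits exist because [K] is complete; they form a thread because contractions are
    continuous; the convergence is uniform because the Cauchy condition is. *)
Lemma limit_complete (F : set_system L) : ProperFilter F -> cauchy F -> cvg F.
Proof.
move=> FF /cauchyP Fc.
have cvgx x : cvg ((fun f : L => f x) @ F).
  apply/cauchy_cvgP/cauchyP => e e0; have [f Ff] := Fc e e0.
  exists (f x); suff : F ((fun f : L => f x) @^-1` ball (f x) e) by [].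
  apply: filterS Ff => g; rewrite limit_ballE /preimage/= -ball_normE /=.
  exact/le_lt_trans/limit_dist_ge.
pose h x := lim ((fun f : L => f x) @ F).
have hP x e : 0 < e -> F [set f | `|h x - f x| < e].
  by move=> e0; have /cvgrPdist_lt := cvgx x; exact.
(* [g] depends on [x] but the bound does not, so it gives both the boundedness of [h] and uniform
   convergence. *)
have close e f : 0 < e -> F (ball f e) -> forall x, `|f x - h x| <= e + e.
  move=> e0 Ff x; have [g [fg hg]] := filter_ex (filterI Ff (hP x e e0)).
  rewrite -(subrK (g x) (f x)) -addrA; apply: le_trans (ler_normD _ _) _.
  apply: lerD; last by rewrite distrC ltW.
  move: fg; rewrite limit_ballE => /ltW; apply: le_trans.
  exact: limit_dist_ge.
have hth : h \in threads.
  apply/asboolP; split; last first.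
    have [f Ff] := Fc 1 ltr01; exists (`|f| + (1 + 1)) => x.
    rewrite -(subrK (f x) (h x)) addrC; apply: le_trans (ler_normD _ _) _.
    by apply: lerD; [exact: limit_norm_ge|rewrite distrC; exact: close].
  move=> x y W xy; apply/eqP; rewrite -subr_eq0 -normr_eq0; apply/eqP.
  apply: le_anti; rewrite normr_ge0 andbT; apply/ler_addgt0Pl => e e0.
  have e2 : 0 < e / 2 by rewrite divr_gt0.
  have [f [hx hy]] := filter_ex (filterI (hP x _ e2) (hP y _ e2)).
  have <- : W (f y) - f x + (f x - h x) + W (h y - f y) = W (h y) - h x.
    rewrite linearB; move: (W (f y)) (W (h y)) (f x) (h x) => a b c d.
    by rewrite subrKA addrC subrKA.
  rewrite ((limit_thread f).1 _ _ _ xy) subrr add0r addr0 [leRHS](splitr e).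
  apply: le_trans (ler_normD _ _) _; apply: lerD; first by rewrite distrC ltW.
  by apply: le_trans (sys_contraction xy _) _; rewrite ltW.
apply/cvg_ex; exists (LimitSpace hth); apply/cvgrPdist_le => e e0.
(* [close] doubles this quarter of [e], which puts the limit within [e / 2] of [f]; [g] is within
   [e / 4] of [f]. *)
have e4 : 0 < e / 2 / 2 by rewrite !divr_gt0.
have [f Ff] := Fc _ e4; apply: (filterS _ Ff) => g fg.
apply: limit_norm_le => x; rewrite limit_funD limit_funN /=.
rewrite -(subrKA (f x)) [leRHS]splitr; apply: le_trans (ler_normD _ _) _.
apply: lerD; first by rewrite [leRHS]splitr distrC; exact: close.
apply: le_trans (limit_dist_ge _ _ _) _; move: fg; rewrite limit_ballE => /ltW.
by move/le_trans; apply; rewrite [leRHS]splitr lerDl ltW.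
Qed.

HB.instance Definition _ := Uniform_isComplete.Build L limit_complete.

End Threads.

(** * The inner product of the inverse limit *)

Section LimitDot.
Variables (R : realType) (D : contractionSystem R).
Local Notation C := R[i].
Local Notation K := (sys_space D).
Local Notation X := (sys_index D).
Local Notation L := (limitSpace D).
Implicit Types f g : L.

Definition tails : set_system X :=
  [set A | exists x, forall y W, sys_map x y W -> A y].

Global Instance tails_filter : ProperFilter tails.
Proof.
split.
  by case=> x; have [z [W [W' [xz _]]]] := sys_directed x x => /(_ _ _ xz).
split; first by exists (sys_point D).
- move=> A B [x xA] [y yB]; have [z [W [W' [xz yz]]]] := sys_directed x y.
  exists z => t V zt; split.
    by have [V' /xA] := sys_trans xz zt.
  by have [V' /yB] := sys_trans yz zt.
- by move=> A B AB [x xA]; exists x => y W /xA/AB.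
Qed.

Lemma limit_norm_mono f x y W : sys_map x y W -> `|f x| <= `|f y|.
Proof.
move=> xy; rewrite -((limit_thread f).1 _ _ _ xy).
exact: sys_contraction xy _.
Qed.

(** Monotone convergence along a directed set: above an index where the supremum is nearly attained,
    the norms stay between that value and the supremum. *)
Lemma limit_norm_cvg f : (fun x => `|f x| : C^o) @ tails --> (`|f| : C^o).
Proof.
apply/cvgrPdist_lt => e e0; rewrite limit_normE /limit_norm.
have e0' : 0 < complex.Re e by move: e0; rewrite ltcE => /andP[].
have [_ [x _ <-] hx] := sup_adherent e0' (limit_norms_sup f).
exists x => y W /(limit_norm_mono f) xy.
rewrite ger0_norm ?subr_ge0; last exact: limit_norm_ge.
rewrite norm_ReE -rmorphB/= -(RRe_real (gtr0_real e0)) ltcR.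
rewrite ltrBlDr -ltrBlDl; apply: lt_le_trans hx _.
by move: xy; rewrite lecE => /andP[].
Qed.

Arguments limit_norm_cvg : clear implicits.

Lemma limit_norm2_cvg f :
  (fun x => `|f x| ^+ 2 : C^o) @ tails --> (`|f| ^+ 2 : C^o).
Proof.
exact: (cvgM (limit_norm_cvg f) (limit_norm_cvg f)).
Qed.

Arguments limit_norm2_cvg : clear implicits.

Definition limit_dot f g : C := lim ((fun x => hdot K (f x) (g x) : C^o) @ tails).

(* By polarization, as the norms along a thread increase to a finite limit. *)
Lemma limit_dot_cvg f g :
  (fun x => hdot K (f x) (g x) : C^o) @ tails --> (limit_dot f g : C^o).
Proof.
pose j : C := 'i%C.
have jC : Num.conj j = - j by rewrite -[LHS]/(conjc j); simpc.
have j2 : j ^+ 2 = -1 by exact: sqr_i.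
apply/cvg_ex; exists (4^-1 * (`|f + g| ^+ 2 - `|f - g| ^+ 2 +
    j * (`|f + j *: g| ^+ 2) - j * (`|f - j *: g| ^+ 2)) : C^o).
rewrite (_ : (fun x => _) = fun x => 4^-1 * (`|(f + g) x| ^+ 2 - `|(f - g) x| ^+ 2 +
    j * (`|(f + j *: g) x| ^+ 2) - j * (`|(f - j *: g) x| ^+ 2)) : C^o).
  apply: cvgMl_tmp; apply: cvgB; last by apply: cvgMl_tmp; exact: limit_norm2_cvg.
  apply: cvgD; last by apply: cvgMl_tmp; exact: limit_norm2_cvg.
  by apply: cvgB; exact: limit_norm2_cvg.
apply/funext => x; rewrite !(limit_funD, limit_funN, limit_funZ).
by rewrite -polarization// mulrA mulVf ?mul1r// pnatr_eq0.
Qed.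

Arguments limit_dot_cvg : clear implicits.

Lemma limit_dot_unique f g (l : C) :
  (fun x => hdot K (f x) (g x) : C^o) @ tails --> (l : C^o) ->
  limit_dot f g = l.
Proof.
move=> h; exact: (cvg_lim (@norm_hausdorff _ C^o) h).
Qed.

Lemma limit_dotP a f f' g :
  limit_dot (a *: f + f') g = a * limit_dot f g + limit_dot f' g.
Proof.
apply: limit_dot_unique.
rewrite (_ : (fun x => _) = fun x => a * hdot K (f x) (g x) + hdot K (f' x) (g x) : C^o).
  apply: cvgD; last exact: limit_dot_cvg.
  by apply: cvgMl_tmp; exact: limit_dot_cvg.
by apply/funext => x; rewrite limit_funD limit_funZ hdotDl hdotZl.
Qed.

Lemma limit_dotC f g : limit_dot f g = Num.conj (limit_dot g f).
Proof.
apply: limit_dot_unique; apply/cvgrPdist_lt => e e0.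
have /cvgrPdist_lt/(_ _ e0) := limit_dot_cvg g f.
apply: filterS => x; rewrite (hdotC (f x)) -rmorphB/=.
by rewrite norm_conjC.
Qed.

Lemma limit_dot_norm f : limit_dot f f = `|f| ^+ 2.
Proof.
apply: limit_dot_unique; rewrite (_ : (fun x => _) = fun x => `|f x| ^+ 2 : C^o).
  exact: limit_norm2_cvg.
by apply/funext => x; rewrite hdot_norm.
Qed.

Lemma limit_dot_bilinear : bilinear_for *%R (Num.conj \; *%R) limit_dot.
Proof.
split=> [g a f f'|f a g g']; first exact: limit_dotP.
by rewrite limit_dotC limit_dotP rmorphD rmorphM/= -!limit_dotC.
Qed.

HB.instance Definition _ := bilinear_isBilinear.Build C L L C
  *%R (Num.conj \; *%R) limit_dot limit_dot_bilinear.

Lemma limit_dot_hermitian f g :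
  limit_dot f g = (-1) ^+ false * Num.conj (limit_dot g f).
Proof. by rewrite expr0 mul1r -limit_dotC. Qed.

HB.instance Definition _ := isHermitianSesquilinear.Build C L false Num.conj
  limit_dot limit_dot_hermitian.

Lemma limit_dot_gt0 f : f != 0 -> 0 < limit_dot f f.
Proof. by rewrite limit_dot_norm -normr_gt0 => f0; rewrite exprn_gt0. Qed.

HB.instance Definition _ := isDotProduct.Build C L limit_dot limit_dot_gt0.

Definition limit_hilbert : hilbertSpace R :=
  @HilbertSpace R L limit_dot limit_dot_norm.

End LimitDot.

Arguments limit_norm_cvg {R D} f.
Arguments limit_norm2_cvg {R D} f.
Arguments limit_dot_cvg {R D} f g.

(** * The unitary representation induced from the Hecke algebra *)

Section Induced.
Variables (R : realType) (G : groupType) (H : groupClosed G).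
Local Notation Gb := (Gbar H).
Local Notation Hb := (Hbar H).
Local Notation p := (projH R H).
Local Notation C := R[i].
Variables (hecke : hecke_pair H) (directed : directed_pair H).
Variables (mu : {measure set (borelGbar H) -> \bar R}) (haar : left_haar mu).
Variables (Delta : Gb -> R) (modular : modular_function mu Delta).
Variables (K : hilbertSpace R) (pi : (Gb -> R[i]^o) -> {linear K -> K}).
Hypothesis rep :
  star_rep (convol mu) (invol Delta) (hecke_algebra mu) pi.
Implicit Types (v w : K) (x y t : Gb).

Local Notation heckeP := (hecke_algebraP hecke haar _).

(** [P] is a projection, possibly proper because [pi] may be degenerate. For [t] in [dirTbar], [V t]
    is a partial isometry with initial projection [P], and [W t] is its adjoint. *)
Let P := pi p.
Let V t := pi (chi t).
Let W t := pi (invol Delta (chi t)).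

Let hp : hecke_algebra mu p := projH_hecke hecke haar.
Let hchi t (tT : dirTbar t) : hecke_algebra mu (chi t) :=
  chi_hecke hecke haar tT.
Let hichi t (tT : dirTbar t) : hecke_algebra mu (invol Delta (chi t)) :=
  invol_hecke hecke haar modular (hchi tT).

Lemma piM f g v : hecke_algebra mu f -> hecke_algebra mu g ->
  pi (convol mu f g) v = pi f (pi g v).
Proof. by case: rep => _ _ piM _ hf hg; exact: piM. Qed.

Lemma pi_adj f v w : hecke_algebra mu f ->
  hdot K (pi f v) w = hdot K v (pi (invol Delta f) w).
Proof. by case: rep => _ _ _ adj hf; exact: adj. Qed.

Lemma pi_lin a f g v : hecke_algebra mu f -> hecke_algebra mu g ->
  pi (a *: f + g) v = a *: pi f v + pi g v.
Proof. by case: rep => _ + _ _ => piP hf hg; exact: piP. Qed.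

Let PP v : P (P v) = P v.
Proof.
by rewrite /P -piM// (convol_projl hecke haar)//; exact: (projH_invariant R hecke).1.
Qed.

Let P_adj v w : hdot K (P v) w = hdot K v (P w).
Proof. by rewrite /P pi_adj// (invol_projH hecke haar modular). Qed.

Let P_norm v : `|P v| <= `|v|.
Proof.
apply: le_of_sqr_le_mul => //; rewrite -hdot_norm P_adj PP.
rewrite -[leLHS]ger0_norm; last by rewrite -PP -P_adj hdot_norm exprn_ge0.
by apply: le_trans (cauchy_schwarz _ _) _; rewrite mulrC.
Qed.

Let VW_adj t v w : dirTbar t -> hdot K (V t v) w = hdot K v (W t w).
Proof. by move=> tT; rewrite pi_adj//; exact: hchi. Qed.

Let WV_adj t v w : dirTbar t -> hdot K (W t v) w = hdot K v (V t w).
Proof. by move=> tT; rewrite hdotC -VW_adj// -hdotC. Qed.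

Let WV t v : dirTbar t -> W t (V t v) = P v.
Proof.
move=> tT; rewrite /W /V -piM; [|exact: hichi|exact: hchi].
rewrite -[in X in convol _ _ X](gmulg1 t).
rewrite (convol_invol_chi hecke haar modular) (chi1 hecke).
by rewrite (convol_projl hecke haar)//; exact: (projH_invariant R hecke).1.
Qed.

Let V_comp s t v : dirTbar s -> dirTbar t -> V (s ** t) v = V s (V t v).
Proof.
move=> sT tT; rewrite /V -piM; [|exact: hchi|exact: hchi].
by rewrite (convol_chi hecke haar).
Qed.

Let W_comp s t v : dirTbar s -> dirTbar t -> W (s ** t) v = W t (W s v).
Proof.
move=> sT tT; apply: hdot_ext => w.
rewrite WV_adj; last exact: dirTbarM.
by rewrite V_comp// !WV_adj.
Qed.

Let V_norm t v : dirTbar t -> `|V t v| <= `|v|.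
Proof.
move=> tT; apply: le_trans (P_norm v).
rewrite -(@ler_pXn2r _ 2)// ?nnegrE// -!hdot_norm.
by rewrite VW_adj// WV// P_adj PP.
Qed.

Let W_norm t v : dirTbar t -> `|W t v| <= `|v|.
Proof.
move=> tT; apply: le_of_sqr_le_mul => //.
rewrite -hdot_norm WV_adj// -[leLHS]ger0_norm; last first.
  by rewrite -WV_adj// hdot_norm exprn_ge0.
apply: le_trans (cauchy_schwarz _ _) _; rewrite mulrC.
by apply: ler_wpM2r => //; exact: V_norm.
Qed.

Definition induced_map x y : set {linear K -> K} :=
  [set W' | exists2 t, dirTbar t & y = t ** x /\ W' = W t].

Lemma induced_contraction x y W' : induced_map x y W' -> forall v, `|W' v| <= `|v|.
Proof. by move=> [t tT [_ ->]] v; exact: W_norm. Qed.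

Lemma induced_trans x y z W' W'' : induced_map x y W' -> induced_map y z W'' ->
  exists W''', induced_map x z W'''.
Proof.
move=> [t tT [-> _]] [s sT [-> _]]; exists (W (s ** t)), (s ** t).
  exact: dirTbarM.
by rewrite gmulA.
Qed.

(** Directedness at [x y^-1] gives [s] with [s] and [s x y^-1] in [dirTbar], and then [s x] is above
    both [x] and [y]. *)
Lemma induced_directed x y : exists z W' W'',
  induced_map x z W' /\ induced_map y z W''.
Proof.
have [s sT st] := Gbar_directed hecke directed (x ** ginv y).
exists (s ** x), (W s), (W (s ** (x ** ginv y))); split; first by exists s.
exists (s ** (x ** ginv y)) => //; split=> //.
by rewrite -!gmulA (gmulVg hecke) gmulg1.
Qed.

Definition induced_system := ContractionSystem (gone H)
  induced_contraction induced_trans induced_directed.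

Local Notation L := (limitSpace induced_system).
Implicit Types f g : L.

Let induced_step f x t : dirTbar t -> W t (f (t ** x)) = f x.
Proof. by move=> tT; apply: (limit_thread f).1; exists t. Qed.

(** The system is ordered by left multiplication, which commutes with right translation. *)
Lemma shift_thread y f : (fun x => f (x ** y)) \in @threads R induced_system.
Proof.
apply/asboolP; split; last first.
  by have [_ [M fM]] := limit_thread f; exists M => x.
move=> x z W' [t tT [-> ->]]; rewrite -gmulA; exact: induced_step.
Qed.

Definition shift y f : L := LimitSpace (shift_thread y f).

Lemma shift_linear y : linear (shift y).
Proof. by move=> a f g; apply: limit_ext. Qed.

HB.instance Definition _ y :=
  GRing.isLinear.Build C L L *:%R (shift y) (shift_linear y).

Definition induced_rep y : {linear L -> L} := shift y.

Local Notation U := induced_rep.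

Lemma induced_repE y f x : U y f x = f (x ** y). Proof. by []. Qed.

Lemma induced_rep_norm_le y f : `|U y f| <= `|f|.
Proof. by apply: limit_norm_le => x; rewrite induced_repE; exact: limit_norm_ge. Qed.

Lemma induced_repM x y f : U (x ** y) f = U x (U y f).
Proof. by apply: limit_ext => z; rewrite !induced_repE gmulA. Qed.

Lemma induced_rep1 f : U (gone H) f = f.
Proof. by apply: limit_ext => z; rewrite induced_repE gmulg1. Qed.

Lemma induced_rep_norm y f : `|U y f| = `|f|.
Proof.
apply: le_anti; rewrite induced_rep_norm_le /= -[in leLHS](induced_rep1 f).
by rewrite -(gmulVg hecke y) induced_repM induced_rep_norm_le.
Qed.

Let P_fix f x : P (f x) = f x.
Proof.
have tT : dirTbar (gone H) by apply: (dirTbar_Hbar hecke); exact: gone_Hbar.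
rewrite -[in RHS](induced_step f x tT) gmul1g /W (chi1 hecke).
by rewrite (invol_projH hecke haar modular).
Qed.

Let chi_Hbar h : Hb h -> chi h = p.
Proof.
move=> hH; rewrite -(chi1 hecke) /chi; congr (\1_ _).
apply/seteqP; split=> x; apply: (hcoset_trans hecke).
  by rewrite (hcoset1 hecke).
by apply: (hcoset_sym hecke); rewrite (hcoset1 hecke).
Qed.

(** Elements [h] of [Hb] lie in [dirTbar] with [W h = P], and [P] fixes the values of a thread. *)
Lemma limit_left_invariant f h x : Hb h -> f (h ** x) = f x.
Proof.
move=> hH; rewrite -(induced_step f x (dirTbar_Hbar hecke hH)) /W chi_Hbar//.
by rewrite (invol_projH hecke haar modular) P_fix.
Qed.

(** Pythagoras: [V t u] is the orthogonal projection of [v] to the range of [V t] and has the norm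
    of [u]. *)
Let defect_eq t u v : dirTbar t -> W t v = u -> P u = u ->
  `|v - V t u| ^+ 2 = `|v| ^+ 2 - `|u| ^+ 2.
Proof.
move=> tT Wv Pu; rewrite -!hdot_norm hdotBl !hdotBr.
rewrite (VW_adj _ _ tT) (VW_adj _ _ tT) WV// Pu Wv subrr subr0.
by rewrite (hdotC v (V t u)) (VW_adj _ _ tT) Wv -hdotC.
Qed.

Let defect f a t : dirTbar t ->
  `|f (t ** a) - V t (f a)| ^+ 2 <= `|f| ^+ 2 - `|f a| ^+ 2.
Proof.
move=> tT; have -> := defect_eq tT (induced_step f a tT) (P_fix f a).
by rewrite lerD2r lerXn2r ?nnegrE//; exact: limit_norm_ge.
Qed.

(** Choose [a] where [f0] nearly attains its norm. For [y] near [y0] the vectors [U y f] and [f0]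
    have the same norm and the same value at [a], so at [t ** a] both are within [e / 2] of
    [V t (f0 a)]. *)
Lemma induced_rep_continuous f : continuous (fun y => U y f).
Proof.
move=> y0; apply/(@cvgrPdist_le _ _ _ (nbhs y0) (nbhs_filter y0)) => e e0.
pose f0 := U y0 f.
have e20 : 0 < e / 2 by rewrite divr_gt0.
have /cvgrPdist_lt/(_ _ (exprn_gt0 2 e20)) := limit_norm2_cvg (f0 : L).
move=> /(@filter_ex _ _ (tails_filter induced_system)) [a /= ae].
have defa : `|f0| ^+ 2 - `|f0 a| ^+ 2 <= (e / 2) ^+ 2.
  by apply: le_trans (ltW ae); apply: real_ler_norm; rewrite realB ?realX ?normr_real.
have oN : open [set y | Hb (a ** y ** ginv (a ** y0))].
  have /continuousP c1 := @gmull_continuous _ H a.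
  have /continuousP c2 := @gmulr_continuous _ H (ginv (a ** y0)).
  exact: (c1 _ (c2 _ (@open_Hbar _ H))).
have nN : nbhs y0 [set y | Hb (a ** y ** ginv (a ** y0))].
  by apply: open_nbhs_nbhs; split=> //=; rewrite (gmulgV hecke); exact: gone_Hbar.
apply: (@filterS _ (nbhs y0) _ _ _ _ nN) => y /= yN.
have ya : U y f a = f0 a.
  by rewrite /f0 !induced_repE -(limit_left_invariant f (a ** y0) yN) (gmulgKV hecke).
apply: limit_norm_le => x; rewrite limit_funD limit_funN.
(* Every index [x] lies below some [t ** a], and norms of threads grow along the system, so
   comparing at [t ** a] is enough. *)
have [z [W1 [_ [xz [t tT [zE _]]]]]] := induced_directed x a.
have := limit_norm_mono (f0 - U y f : L) xz.
rewrite limit_funD limit_funN => /le_trans; apply; rewrite {}zE.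
apply: le_trans (ler_distD (V t (f0 a)) _ _) _; rewrite [leRHS]splitr.
apply: lerD; rewrite -(@ler_pXn2r _ 2)// ?nnegrE ?(ltW e20)//.
  exact: le_trans (defect f0 a tT) _.
rewrite distrC -ya; apply: le_trans (defect (U y f) a tT) _.
by rewrite ya induced_rep_norm -(induced_rep_norm y0).
Qed.

Lemma induced_rep_unitary :
  unitary_rep (K := limit_hilbert induced_system) induced_rep.
Proof.
split; [exact: induced_rep1|by move=> x y f; exact: induced_repM| |exact: induced_rep_continuous].
move=> x f g; pose j : C := 'i%C.
have jC : Num.conj j = - j by rewrite -[LHS]/(conjc j); simpc.
have j2 : j ^+ 2 = -1 by exact: sqr_i.
have four0 : (4 : C) != 0 by rewrite pnatr_eq0.
apply: (mulfI four0); rewrite !(polarization _ _ jC j2).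
by rewrite -!linearZ -!linearD -!linearB !induced_rep_norm.
Qed.

(** * The vectors of [K] inside the induced space *)

Let phi x v := pi (convol mu p (chi x)) v.

Let hphi x : hecke_algebra mu (convol mu p (chi x)).
Proof.
apply: (hecke_algebra_convol_projl hecke haar).
  exact: (chi_right_invariant hecke).
exact: chi_coset_finite.
Qed.

(** Valid for every admissible [s], this factorization gives both the norm bound and the
    compatibility of [phi]. *)
Let phiE s x v : dirTbar s -> dirTbar (s ** x) -> phi x v = W s (V (s ** x) v).
Proof.
move=> sT sxT; rewrite /W /V -piM; [|exact: hichi|exact: hchi].
by rewrite (convol_invol_chi hecke haar modular).
Qed.

Let phi_dirTbar t v : dirTbar t -> phi t v = V t v.
Proof.
by move=> tT; rewrite /phi (convol_projl hecke haar)//; exact: (chi_left_invariant hecke).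
Qed.

Let W_phi t x v : dirTbar t -> W t (phi (t ** x) v) = phi x v.
Proof.
(* The choice serves twice: [s] for the point [t x], and [s t] for the point [x]. *)
move=> tT; have [s sT stx] := Gbar_directed hecke directed (t ** x).
rewrite (phiE _ sT stx) -W_comp// gmulA -(phiE _ (dirTbarM hecke sT tT))//.
by rewrite -gmulA.
Qed.

Let phi_norm x v : `|phi x v| <= `|v|.
Proof.
have [s sT sx] := Gbar_directed hecke directed x.
by rewrite (phiE _ sT sx); apply: le_trans (W_norm _ sT) _; exact: V_norm.
Qed.

Lemma orbit_thread v : phi^~ v \in @threads R induced_system.
Proof.
apply/asboolP; split; last by exists `|v| => x; exact: phi_norm.
by move=> x y W' [t tT [-> ->]]; exact: W_phi.
Qed.

(* In the space of the induced representation [orbit_vector v] is the vector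
   [v] itself: it maps [x] to the compression to [K] of [U x v]. *)
Definition orbit_vector v : L := LimitSpace (orbit_thread v).

Lemma orbit_vector_norm v : `|orbit_vector v| <= `|v|.
Proof. by apply: limit_norm_le => x; exact: phi_norm. Qed.

(** Above the index 1 the net of inner products is constant: at [t] it is [<phi(t x) v, V_t w> =
    <W_t phi(t x) v, w>], and compatibility of [phi] applies. *)
Lemma orbit_vector_dot x v w :
  limit_dot (U x (orbit_vector v)) (orbit_vector w) = hdot K (phi x v) w.
Proof.
apply: limit_dot_unique; apply/cvgrPdist_lt => e e0.
exists (gone H) => y W' [t tT [-> _]]; rewrite gmulg1.
rewrite [X in _ - X](_ : _ = hdot K (phi (t ** x) v) (phi t w))//.
by rewrite (phi_dirTbar _ tT) -(WV_adj _ _ tT) W_phi// subrr normr0.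
Qed.

Lemma hecke_algebra0 : hecke_algebra mu 0.
Proof.
apply/heckeP; split => //; exists [::] => x.
by rewrite eqxx.
Qed.

Lemma pi0 v : pi 0 v = 0.
Proof.
have := pi_lin 1 v hecke_algebra0 hecke_algebra0.
by rewrite scale1r scale1r addr0 => /eqP; rewrite -subr_eq subrr eq_sym => /eqP.
Qed.

(** Induction over cosets leaves the Hecke algebra, as [chi x] need not be left invariant. So the
    identity is proved for right invariant [k] of finite support, with [pi] applied to [p * k];
    [p * f = f] brings it back. *)
Lemma integrated_form_orbit (f : Gb -> R[i]^o) v w : hecke_algebra mu f ->
  integrated_form mu (K := limit_hilbert induced_system) induced_rep f
    (orbit_vector v) (orbit_vector w) = hdot K (pi f v) w.
Proof.
move=> /[dup] hf /heckeP[fl fr fs].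
rewrite /integrated_form -[in RHS](convol_projl hecke haar fl).
rewrite (eq_cintegral _ (F' := fun x => f x * hdot K (phi x v) w)); last first.
  by move=> x; congr (_ * _); exact: orbit_vector_dot.
(* Integrability and membership are carried along because the integral and [pi] are additive only
   under them. *)
pose Q (k : Gb -> R[i]^o) :=
  [/\ cintegrable mu (fun x => k x * hdot K (phi x v) w : R[i]^o),
      hecke_algebra mu (convol mu p k) &
      cintegral mu (fun x => k x * hdot K (phi x v) w) =
        hdot K (pi (convol mu p k) v) w].
suff : Q f by case.
clear hf fl; move: f fr fs; apply: (right_invariant_ind hecke).
  have E0 : (fun x => (0 : Gb -> R[i]^o) x * hdot K (phi x v) w) = 0 :> (Gb -> R[i]^o).
    by apply/funext => x; rewrite mul0r.
  have p0 : convol mu p 0 = 0.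
    by apply: (convol_projl hecke haar) => h x _.
  rewrite /Q E0 p0; split; [exact: cintegrable0|exact: hecke_algebra0|].
  by rewrite cintegral0 pi0 hdot0l.
move=> a x k kr ks [ki kh kE].
have E0 : (fun y => (a *: chi x + k) y * hdot K (phi y v) w) =
   (a * hdot K (phi x v) w) *: chi x + (fun y => k y * hdot K (phi y v) w) :> (Gb -> R[i]^o).
  apply/funext => y; rewrite !fctE mulrDl; congr (_ + _).
  rewrite /chi indicE; case: (pselect (hcoset x y)) => xy; last first.
    by rewrite memNset// !scaler0 mul0r.
  rewrite mem_set// [RHS]mulr1; congr (_ * _); first exact: mulr1.
  (* [phi] depends only on the coset of its argument. *)
  congr (hdot K _ w).
  rewrite /phi (_ : chi y = chi x)// /chi; congr (\1_ _).
  apply/seteqP; split=> z; apply: (hcoset_trans hecke) => //.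
  exact: (hcoset_sym hecke).
have hx := hphi x.
rewrite /Q E0 (convol_projl_lin hecke haar)//; split.
- by apply: cintegrableD => //; apply: cintegrableZ; exact: (cintegrable_chi hecke haar).
- exact: (hecke_algebra_lin hecke haar).
rewrite cintegralD//; last by apply: cintegrableZ; exact: (cintegrable_chi hecke haar).
rewrite cintegralZ; last exact: (cintegrable_chi hecke haar).
by rewrite (cintegral_chi hecke haar) mulr1 kE pi_lin// hdotDl hdotZl.
Qed.

Variables (A : cstarAlgebra R) (iota : (Gb -> R[i]^o) -> A).
Hypothesis full : full_group_cstar mu Delta iota.

(** The C*-norm dominates the coefficients of unitary representations at vectors of the unit ball;
    [orbit_vector] does not increase norms, and its coefficients are those of [pi f]. *)
Lemma hecke_rep_bound (f : Gb -> R[i]^o) v : hecke_algebra mu f ->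
  `|pi f v| <= `|iota f| * `|v|.
Proof.
move=> hf.
have unit_bound v' w' : `|v'| <= 1 -> `|w'| <= 1 ->
    `|hdot K (pi f v') w'| <= `|iota f|.
  move=> v1 w1; case: full => _ _ _ /(_ f (hecke_algebra_Cc hecke haar hf))[ub _] _.
  apply: ub; exists (limit_hilbert induced_system), induced_rep,
    (orbit_vector v'), (orbit_vector w'); split.
  - exact: induced_rep_unitary.
  - exact: le_trans (orbit_vector_norm _) _.
  - exact: le_trans (orbit_vector_norm _) _.
  - by rewrite integrated_form_orbit.
have [->|v0] := eqVneq v 0; first by rewrite linear0 !normr0 mulr0.
have [->|u0] := eqVneq (pi f v) 0; first by rewrite normr0 mulr_ge0.
have nv : `|v| != 0 by rewrite normr_eq0.
have nu : `|pi f v| != 0 by rewrite normr_eq0.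
(* At the normalised vectors [v] and [pi f v] the coefficient is [|pi f v| / |v|]. *)
have := unit_bound (`|v|^-1 *: v) (`|pi f v|^-1 *: pi f v).
rewrite !normrZ !normfV !normr_id !mulVf// => /(_ (lexx _) (lexx _)).
rewrite [pi f (_ *: _)]linearZ hdotZl hdotZr hdot_norm geC0_conj ?invr_ge0//.
rewrite expr2 mulKf// normrM normfV !normr_id.
by rewrite mulrC ler_pdivrMr// normr_gt0.
Qed.

End Induced.

(** * Extension of bounded representations to the closure *)

Section CstarNorm.
Variables (R : realType) (A : cstarAlgebra R).
Implicit Types a b : A.

Lemma norm_cstar a : `|cstar a| = `|a|.
Proof.
have le_star b : `|b| <= `|cstar b|.
  apply: le_of_sqr_le_mul => //; rewrite -cnorm_star mulrC.
  exact: cnormM.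
by apply: le_anti; rewrite le_star -[X in _ <= `|X| ]cstarK le_star.
Qed.

Lemma cmulBr a b c : cmul a (b - c) = cmul a b - cmul a c :> A.
Proof.
by rewrite -(addrC (- c)) -scaleN1r cmul_linearr scaleN1r addrC.
Qed.

Lemma cmulBl a b c : cmul (b - c) a = cmul b a - cmul c a :> A.
Proof.
by rewrite -(addrC (- c)) -scaleN1r (cmul_linearl a) scaleN1r addrC.
Qed.

Lemma cstarB a b : cstar (a - b) = cstar a - cstar b :> A.
Proof.
by rewrite -(addrC (- b)) -scaleN1r cstar_conj_linear rmorphN rmorph1 scaleN1r addrC.
Qed.

End CstarNorm.

Lemma norm_small_eq0 (C : numFieldType) (V : normedZmodType C) (x : V) (M : C) :
  0 <= M -> (forall e, 0 < e -> e <= 1 -> `|x| <= e * M) -> x = 0.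
Proof.
move=> M0 xM; apply/eqP; rewrite -normr_le0; apply/ler_addgt0Pl => e e0.
rewrite addr0; have M1 : 0 < M + 1 by rewrite ltr_wpDl.
have eM0 : 0 < e + (M + 1) by exact: addr_gt0.
(* A positive number, at most 1, whose product with [M] is at most [e]. *)
have d0 : 0 < e / (e + (M + 1)) by rewrite divr_gt0.
have d1 : e / (e + (M + 1)) <= 1.
  by rewrite ler_pdivrMr// mul1r lerDl ltW.
apply: le_trans (xM _ d0 d1) _; rewrite mulrAC ler_pdivrMr//.
by rewrite ler_pM2l// addrCA lerDl addr_ge0// ltW.
Qed.

Section Extension.
Variables (R : realType) (E : lmodType R[i]) (mul : E -> E -> E) (star : E -> E).
Variables (D : set E) (A : cstarAlgebra R) (iota : E -> A).
Variables (K : hilbertSpace R) (pi : E -> {linear K -> K}).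
Local Notation C := R[i].
Hypothesis D_lin : forall a f g, D f -> D g -> D (a *: f + g).
Hypothesis D_mul : forall f g, D f -> D g -> D (mul f g).
Hypothesis D_star : forall f, D f -> D (star f).
Hypothesis iota_lin : forall a f g, D f -> D g ->
  iota (a *: f + g) = a *: iota f + iota g.
Hypothesis iota_mul : forall f g, D f -> D g ->
  iota (mul f g) = cmul (iota f) (iota g).
Hypothesis iota_star : forall f, D f -> iota (star f) = cstar (iota f).
Hypothesis rep : star_rep mul star D pi.
Hypothesis bound : forall f v, D f -> `|pi f v| <= `|iota f| * `|v|.
Implicit Types (f g : E) (a b : A) (v w : K).

Let cl : set A := closure (iota @` D).

Lemma closure_approx a e : cl a -> 0 < e ->
  exists2 f, D f & `|iota f - a| <= e.
Proof.
move=> cla e0; have [_ [[f Df <-]]] := cla _ (nbhsx_ballx a e e0).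
by rewrite -ball_normE /= distrC => /ltW; exists f.
Qed.

Let piB f g v : D f -> D g -> `|pi f v - pi g v| <= `|iota f - iota g| * `|v|.
Proof.
move=> Df Dg; case: rep => _ pi_lin _ _.
have -> : pi f v - pi g v = pi (-1 *: g + f) v.
  by rewrite pi_lin// scaleN1r addrC.
have -> : iota f - iota g = iota (-1 *: g + f).
  by rewrite iota_lin// scaleN1r addrC.
exact/bound/D_lin.
Qed.

(** The value at [v] of the extended operator, described by the Lipschitz estimate it satisfies
    against all of [D]; for [a] in the closure at most one [u] does. *)
Definition is_extension a v (u : K) :=
  forall f, D f -> `|pi f v - u| <= `|iota f - a| * `|v|.

(** The values [pi f v], as [iota f] tends to [a], generate a Cauchy filter whose limit inherits the
    estimate. *)
Lemma extension_exists a v : cl a -> exists u, is_extension a v u.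
Proof.
move=> cla.
pose F : set_system K := [set B | exists2 e : C, 0 < e &
  forall f, D f -> `|iota f - a| <= e -> B (pi f v)].
have FF : ProperFilter F.
  split.
    case=> e e0 FB; have [f Df fa] := closure_approx cla e0.
    exact: FB Df fa.
  split.
  - by exists 1.
  - move=> B B' [e e0 FB] [e' e'0 FB']; have := real_leP (gtr0_real e0) (gtr0_real e'0).
    case=> [ee'|/ltW e'e]; [exists e|exists e'] => // f Df fa; split.
    + exact: FB.
    + by apply: FB' => //; exact: le_trans ee'.
    + by apply: FB => //; exact: le_trans e'e.
    + exact: FB'.
  - by move=> B B' BB' [e e0 FB]; exists e => // f Df fa; apply: BB'; exact: FB.
have Fc : cauchy F.
  (* Approximants within [d] of [a] are within [2 d] of each other; the summand 1 covers [v = 0] and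
     makes the last inequality strict. *)
  apply/cauchyP => e e0; pose d := e / 2 / (`|v| + 1).
  have v1 : 0 < `|v| + 1 by rewrite ltr_wpDl.
  have d0 : 0 < d by rewrite !divr_gt0.
  have [f Df fa] := closure_approx cla d0; exists (pi f v); exists d => // g Dg ga.
  rewrite -ball_normE /=; apply: le_lt_trans (piB _ Df Dg) _.
  have fg : `|iota f - iota g| <= d + d.
    by apply: le_trans (ler_distD a _ _) _; apply: lerD => //; rewrite distrC.
  apply: le_lt_trans (ler_wpM2r (normr_ge0 _) fg) _.
  rewrite -mulrDl -splitr mulrAC ltr_pdivrMr// ltr_pM2l//.
  by rewrite ltrDl.
have Fu : F --> lim F by exact: cauchy_cvg.
exists (lim F) => f Df; move: (lim F) Fu => u Fu.
apply/ler_addgt0Pr => e e0.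
have v1 : 0 < `|v| + 1 by rewrite ltr_wpDl.
have d0 : 0 < e / 2 / (`|v| + 1) by rewrite !divr_gt0.
have e20 : 0 < e / 2 by rewrite divr_gt0.
have Fd : F [set pi g v | g in [set g | D g /\ `|iota g - a| <= e / 2 / (`|v| + 1)]].
  by exists (e / 2 / (`|v| + 1)) => // g Dg ga; exists g.
have [_ [[g [Dg ga] <-] ug]] := filter_ex (filterI Fd (Fu _ (nbhsx_ballx u _ e20))).
move: ug; rewrite -ball_normE /= => ug.
apply: le_trans (ler_distD (pi g v) _ _) _; rewrite (splitr e) [leRHS]addrA.
apply: lerD; last by rewrite distrC ltW.
apply: le_trans (piB _ Df Dg) _.
apply: (@le_trans _ _ ((`|iota f - a| + e / 2 / (`|v| + 1)) * `|v|)).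
  apply: ler_wpM2r => //; apply: le_trans (ler_distD a _ _) _.
  by apply: lerD => //; rewrite distrC.
rewrite mulrDl lerD2l mulrAC ler_pdivrMr// ler_pM2l//.
by rewrite lerDl.
Qed.

(** The value 0 off the closure keeps [extension a] linear in [v] for every [a], as the type of the
    extended representation demands. *)
Definition extension a v : K :=
  if pselect (cl a) then xget 0 (is_extension a v) else 0.

Lemma extensionP a v : cl a -> is_extension a v (extension a v).
Proof.
move=> cla; rewrite /extension; case: (pselect (cl a)) => // ?.
by have [u hu] := extension_exists v cla; exact: xgetI hu.
Qed.

(** [M] is free because linearity in the vector produces a combination of norms instead of [|v|]. *)
Lemma extension_unique a v u (M : C) : cl a -> 0 <= M ->
  (forall f, D f -> `|pi f v - u| <= `|iota f - a| * M) -> extension a v = u.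
Proof.
move=> cla M0 uP; apply/eqP; rewrite -subr_eq0; apply/eqP.
apply: (@norm_small_eq0 _ _ _ (`|v| + M)); first exact: addr_ge0.
move=> e e0 _; have [f Df fa] := closure_approx cla e0.
apply: le_trans (ler_distD (pi f v) _ _) _; rewrite mulrDr distrC.
apply: lerD; first by apply: le_trans (extensionP _ cla Df) _; exact: ler_wpM2r.
by apply: le_trans (uP _ Df) _; exact: ler_wpM2r.
Qed.

Lemma extension_iota f v : D f -> extension (iota f) v = pi f v.
Proof.
move=> Df; apply: (@extension_unique _ _ _ `|v|) => //.
  by apply: subset_closure; exists f.
by move=> g Dg; exact: piB.
Qed.

Lemma extension_linear a : linear (extension a).
Proof.
move=> c v w; case: (pselect (cl a)) => cla; last first.
  by rewrite /extension; case: (pselect (cl a)) => // ?; rewrite scaler0 addr0.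
apply: (@extension_unique _ _ _ (`|c| * `|v| + `|w|)) => //.
move=> f Df; rewrite linearP opprD addrACA -scalerBr.
apply: le_trans (ler_normD _ _) _; rewrite normrZ mulrDr mulrCA.
apply: lerD; last exact: extensionP.
by apply: ler_wpM2l => //; exact: extensionP.
Qed.

HB.instance Definition _ a :=
  GRing.isLinear.Build C K K *:%R (extension a) (extension_linear a).

Lemma extension_bound a v : `|extension a v| <= `|a| * `|v|.
Proof.
case: (pselect (cl a)) => cla; last first.
  by rewrite /extension; case: (pselect (cl a)) => // ?; rewrite normr0 mulr_ge0.
apply/ler_addgt0Pr => e e0.
have v1 : 0 < `|v| + 1 by rewrite ltr_wpDl.
have d0 : 0 < e / 2 / (`|v| + 1) by rewrite !divr_gt0.
have [f Df fa] := closure_approx cla d0.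
rewrite -(subrKC (pi f v) (extension a v)).
apply: le_trans (ler_normD _ _) _.
have e20 : 0 < e / 2 by rewrite divr_gt0.
have dv : e / 2 / (`|v| + 1) * `|v| <= e / 2.
  by rewrite mulrAC ler_pdivrMr// ler_pM2l// lerDl.
rewrite (splitr e) [leRHS]addrA; apply: lerD.
  apply: le_trans (bound _ Df) _; rewrite -(subrK a (iota f)).
  apply: le_trans (ler_wpM2r (normr_ge0 _) (ler_normD _ _)) _.
  rewrite mulrDl [leRHS]addrC lerD2r; apply: le_trans dv; exact: ler_wpM2r.
rewrite distrC; apply: le_trans (extensionP _ cla Df) _.
by apply: le_trans dv; exact: ler_wpM2r.
Qed.

Lemma extension_continuous a : continuous (extension a).
Proof.
apply/linear_bounded_continuous/linear_boundedP; exists `|a|; split=> // r ar v.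
by apply: le_trans (extension_bound a v) _; rewrite ler_wpM2r// ltW.
Qed.

Lemma closure_of_approx a :
  (forall e, 0 < e -> exists2 f, D f & `|iota f - a| <= e) -> cl a.
Proof.
move=> approx B; rewrite -nbhs_ballE => -[e /= e0 eB].
have e20 : 0 < e / 2 by rewrite divr_gt0.
have [f Df fa] := approx _ e20; exists (iota f); split; first by exists f.
apply: eB; rewrite -ball_normE /= distrC; apply: le_lt_trans fa _.
by rewrite ltr_pdivrMr// ltr_pMr// ltr1n.
Qed.

Let extension_close a f v e : cl a -> D f -> `|iota f - a| <= e ->
  `|pi f v - extension a v| <= e * `|v|.
Proof.
move=> cla Df fa; apply: le_trans (extensionP _ cla Df) _; exact: ler_wpM2r.
Qed.

Let lin_close (c : C) a b f g e : `|iota f - a| <= e -> `|iota g - b| <= e ->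
  D f -> D g ->
  `|iota (c *: f + g) - (c *: a + b)| <= e * (`|c| + 1).
Proof.
move=> fa gb Df Dg; rewrite iota_lin// opprD addrACA -scalerBr.
apply: le_trans (ler_normD _ _) _; rewrite normrZ mulrDr mulr1 mulrC.
by apply: lerD => //; exact: ler_wpM2r.
Qed.

Lemma closure_lin (c : C) a b : cl a -> cl b -> cl (c *: a + b).
Proof.
move=> cla clb; apply: closure_of_approx => e e0.
have c1 : 0 < `|c| + 1 by rewrite ltr_wpDl.
have d0 : 0 < e / (`|c| + 1) by rewrite divr_gt0.
have [f Df fa] := closure_approx cla d0.
have [g Dg gb] := closure_approx clb d0.
exists (c *: f + g); first exact: D_lin.
by apply: le_trans (lin_close c fa gb Df Dg) _; rewrite divfK// gt_eqF.
Qed.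

(** As for products and adjoints below, both sides are compared with [pi] at approximants, at a cost
    of [e] times a constant. *)
Lemma extension_lin (c : C) a b v : cl a -> cl b ->
  extension (c *: a + b) v = c *: extension a v + extension b v.
Proof.
move=> cla clb; case: rep => _ pi_lin _ _.
apply/eqP; rewrite -subr_eq0; apply/eqP.
apply: (@norm_small_eq0 _ _ _ ((`|c| + 1) * `|v| + (`|c| * `|v| + `|v|))).
  by rewrite !addr_ge0// mulr_ge0// addr_ge0.
move=> e e0 _; have [f Df fa] := closure_approx cla e0.
have [g Dg gb] := closure_approx clb e0.
apply: le_trans (ler_distD (pi (c *: f + g) v) _ _) _; rewrite mulrDr.
apply: lerD.
  rewrite distrC mulrA; apply: extension_close; [exact: closure_lin|exact: D_lin|].
  exact: lin_close.
rewrite pi_lin// opprD addrACA -scalerBr.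
apply: le_trans (ler_normD _ _) _; rewrite normrZ mulrDr mulrCA.
apply: lerD; last exact: extension_close.
by apply: ler_wpM2l => //; exact: extension_close.
Qed.

(** [e <= 1] bounds [|iota f|] by [|a| + 1], which keeps the estimate linear in [e]. *)
Let mul_close a b f g e : 0 < e -> e <= 1 ->
  `|iota f - a| <= e -> `|iota g - b| <= e -> D f -> D g ->
  `|iota (mul f g) - cmul a b| <= e * (`|a| + 1 + `|b|).
Proof.
move=> e0 e1 fa gb Df Dg; rewrite iota_mul//.
apply: le_trans (ler_distD (cmul (iota f) b) _ _) _; rewrite -cmulBr -cmulBl.
rewrite mulrDr; apply: lerD; apply: le_trans (cnormM _ _) _.
  rewrite mulrC; apply: ler_pM => //; rewrite -(subrK a (iota f)) addrC.
  by apply: le_trans (ler_normD _ _) _; rewrite lerD2l; exact: le_trans e1.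
exact: ler_wpM2r.
Qed.

Lemma closure_mul a b : cl a -> cl b -> cl (cmul a b).
Proof.
move=> cla clb; apply: closure_of_approx => e e0.
pose M := `|a| + 1 + `|b|.
have M1 : 0 < M by rewrite /M -addrA ltr_wpDl// ltr_pwDl.
have eM0 : 0 < e + M by exact: addr_gt0.
have d0 : 0 < e / (e + M) by rewrite divr_gt0.
have d1 : e / (e + M) <= 1 by rewrite ler_pdivrMr// mul1r lerDl ltW.
have [f Df fa] := closure_approx cla d0.
have [g Dg gb] := closure_approx clb d0.
exists (mul f g); first exact: D_mul.
apply: le_trans (mul_close d0 d1 fa gb Df Dg) _.
by rewrite mulrAC ler_pdivrMr// ler_pM2l// lerDr ltW.
Qed.

Lemma extension_mul a b v : cl a -> cl b ->
  extension (cmul a b) v = extension a (extension b v).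
Proof.
move=> cla clb; case: rep => _ _ pi_mul _.
apply/eqP; rewrite -subr_eq0; apply/eqP.
apply: (@norm_small_eq0 _ _ _ ((`|a| + 1 + `|b|) * `|v| +
    (`|extension b v| + `|a| * `|v| + `|v|))).
  by rewrite !addr_ge0// mulr_ge0// !addr_ge0.
move=> e e0 e1; have [f Df fa] := closure_approx cla e0.
have [g Dg gb] := closure_approx clb e0.
have gv := extension_close v clb Dg gb.
apply: le_trans (ler_distD (pi (mul f g) v) _ _) _; rewrite mulrDr.
apply: lerD.
  rewrite distrC mulrA; apply: extension_close; [exact: closure_mul|exact: D_mul|].
  exact: mul_close.
rewrite pi_mul//; apply: le_trans (ler_distD (extension a (pi g v)) _ _) _.
rewrite addrAC mulrDr; apply: lerD.
  apply: le_trans (extension_close _ cla Df fa) _; apply: ler_wpM2l; first exact: ltW.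
  have /le_trans : `|pi g v| <= `|extension b v| + `|pi g v - extension b v|.
    by rewrite -{1}(subrKC (extension b v) (pi g v)) ler_normD.
  by apply; rewrite lerD2l; apply: le_trans gv _; rewrite ler_piMl.
rewrite -linearB; apply: le_trans (extension_bound _ _) _.
by rewrite mulrCA ler_wpM2l.
Qed.

Let star_close a f e : `|iota f - a| <= e -> D f ->
  `|iota (star f) - cstar a| <= e.
Proof. by move=> fa Df; rewrite iota_star// -cstarB norm_cstar. Qed.

Lemma closure_star a : cl a -> cl (cstar a).
Proof.
move=> cla; apply: closure_of_approx => e e0.
have [f Df fa] := closure_approx cla e0.
by exists (star f); [exact: D_star|exact: star_close].
Qed.

Lemma extension_star a v w : cl a ->
  hdot K (extension a v) w = hdot K v (extension (cstar a) w).
Proof.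
move=> cla; case: rep => _ _ _ pi_adj.
apply/eqP; rewrite -subr_eq0; apply/eqP.
apply: (@norm_small_eq0 _ _ _ (`|v| * `|w| + `|v| * `|w|)).
  by rewrite addr_ge0// mulr_ge0.
move=> e e0 _; have [f Df fa] := closure_approx cla e0.
apply: le_trans (ler_distD (hdot K (pi f v) w) _ _) _; rewrite mulrDr.
apply: lerD.
  rewrite -hdotBl; apply: le_trans (cauchy_schwarz _ _) _.
  by rewrite mulrA ler_wpM2r// distrC; exact: extension_close.
rewrite pi_adj// -hdotBr; apply: le_trans (cauchy_schwarz _ _) _.
rewrite mulrCA ler_wpM2l//; apply: extension_close; first exact: closure_star.
  exact: D_star.
exact: star_close.
Qed.

Lemma enveloping_extension (B : set A) : B `<=` closure (iota @` D) ->
  exists Pi : A -> {linear K -> K},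
    star_rep (@cmul R A) (@cstar R A) B Pi /\
    forall f, D f -> forall v, Pi (iota f) v = pi f v.
Proof.
move=> Bcl; exists (fun a => extension a : {linear K -> K}); split; last first.
  by move=> f Df v; exact: extension_iota.
split.
- by move=> a _; exact: extension_continuous.
- by move=> c a b /Bcl cla /Bcl clb v; exact: extension_lin.
- by move=> a b /Bcl cla /Bcl clb v; exact: extension_mul.
- by move=> a /Bcl cla v w; exact: extension_star.
Qed.

End Extension.

(** * Density of the Hecke algebra in the corner *)

Section Corner.
Variables (R : realType) (G : groupType) (H : groupClosed G).
Local Notation p := (projH R H).
Variables (hecke : hecke_pair H).
Variables (mu : {measure set (borelGbar H) -> \bar R}) (haar : left_haar mu).
Variables (Delta : Gbar H -> R) (A : cstarAlgebra R).
Variable iota : (Gbar H -> R[i]^o) -> A.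
Hypothesis full : full_group_cstar mu Delta iota.

(** If [f] in [Cc] approximates [b], then [p * f * p] approximates [q b q], with the error
    multiplied by at most [|q|^2]. *)
Lemma corner_closure :
  corner (iota p) `<=` closure (iota @` hecke_algebra mu).
Proof.
case: full => _ iota_mul _ _ dense _ [b _ <-]; set q := iota p.
have pCc := projH_Cc R hecke.
apply: closure_of_approx => e e0; have q1 : 0 < `|q| * `|q| + 1.
  by rewrite ltr_wpDl// mulr_ge0.
have d0 : 0 < e / (`|q| * `|q| + 1) by rewrite divr_gt0.
have bcl : closure (iota @` @Cc R G H) b by rewrite dense.
have [f fc fb] := closure_approx bcl d0.
have pfc := convol_projl_Cc hecke haar fc.
exists (convol mu (convol mu p f) p); first by exists f.
rewrite iota_mul// iota_mul// -cmulBl -cmulBr.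
apply: le_trans (cnormM _ _) _.
apply: le_trans (ler_wpM2r (normr_ge0 _) (cnormM _ _)) _.
rewrite mulrAC; apply: le_trans (ler_wpM2l (mulr_ge0 _ _) fb) _ => //.
by rewrite mulrCA ler_piMr// ?(ltW e0)// ler_pdivrMr// mul1r lerDl.
Qed.

End Corner.

Theorem theorem6p4 (R : realType) (G : groupType) (H : groupClosed G)
    (hecke : hecke_pair H) (reduced : reduced_pair H)
    (mu : {measure set (borelGbar H) -> \bar R}) (haar : left_haar mu)
    (Delta : Gbar H -> R) (modular : modular_function mu Delta)
    (A : cstarAlgebra R) (iota : (Gbar H -> R[i]^o) -> A)
    (full : full_group_cstar mu Delta iota)
    (directed : directed_pair H) :
  (forall f : Gbar H -> R[i]^o, Ccp mu f ->
     exists (n : nat) (g : 'I_n -> Gbar H -> R[i]^o),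
       [/\ (1 <= n)%N,
           forall i, hecke_algebra mu (g i)
         & convol mu (invol Delta f) f =
           \sum_(i < n) convol mu (invol Delta (g i)) (g i)]) /\
  enveloping (convol mu) (invol Delta) (hecke_algebra mu) iota
    (corner (iota (projH R H))).
Proof.
split=> [f fc|K pi rep].
  have [g hg fg] := inner_product_positive hecke haar modular directed fc.
  by exists 1, (fun=> g); split=> //; rewrite big_ord1.
have Cch f (hf : hecke_algebra mu f) := hecke_algebra_Cc hecke haar hf.
case: (full) => iota_lin iota_mul iota_star _ _.
apply: (enveloping_extension (D := hecke_algebra mu) (mul := convol mu)
  (star := invol Delta)) => //.
- by move=> a f g; exact: hecke_algebra_lin.
- by move=> f g; exact: hecke_algebra_convol.
- by move=> f; exact: (invol_hecke hecke haar modular).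
- by move=> a f g /Cch fc /Cch gc; exact: iota_lin.
- by move=> f g /Cch fc /Cch gc; exact: iota_mul.
- by move=> f /Cch fc; exact: iota_star.
- move=> f v; exact: (hecke_rep_bound hecke directed haar modular rep full).
- exact: (corner_closure hecke haar full).
Qed.
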